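(* Let $V=\mathbb{R}^2(x,y)$ with symplectic form $\omega=dx\wedge dy$, and let the affine conformal symplectic group $H=\mathrm{ACSp}(2,\mathbb{R})=\mathrm{CSp}(2,\mathbb{R})\ltimes\mathbb{R}^2$, where $\mathrm{CSp}(2,\mathbb{R})=\mathrm{Sp}(2,\mathbb{R})\times\mathbb{R}_+$, act on $V$ by affine transformations and trivially on the values $u$ of functions $u=u(x,y)$. Put $I_0=u$, $I'_2=u_{xx}u_{yy}-u_{xy}^2$, $\nabla'_1=(u_xu_{yy}-u_yu_{xy})\mathcal{D}_x-(u_xu_{xy}-u_yu_{xx})\mathcal{D}_y$, $\nabla_2=u_x\mathcal{D}_y-u_y\mathcal{D}_x$, and $$\nabla''_1=\frac1{I'_2}\nabla'_1,\quad \nabla''_2=\frac{I'_2}{\nabla_2(I'_2)}\nabla_2,\quad I''_{3a}=\frac{\nabla'_1(I'_2)}{(I'_2)^2},\quad I''_{3b}=\frac{(\nabla_2(I'_2))^2}{(I'_2)^3}.$$ Then the algebra of differential invariants of the $H$-action on the space $J^\infty(V)$ of infinite jets of functions on $V$ is generated as $$\mathcal{A}_H=\langle I_0,I''_{3a},I''_{3b}\,;\,\nabla''_1,\nabla''_2\ |\ \mathcal{R}_l\rangle$$ for some (unspecified) differential syzygies $\mathcal{R}_l$.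
   Context: $J^k(V)$ is the space of $k$-jets of functions $u=u(x,y)$, with coordinates $x,y,u$ and the partial derivatives of $u$ up to order $k$; $\mathcal{D}_x,\mathcal{D}_y$ are the total derivatives. $H$ acts on $J^k(V)$ by prolongation. A differential invariant of order $k$ is a function on $J^k(V)$ constant on orbits of the prolonged action; differential invariants are taken to be rational functions of the jet-variables (and may be chosen polynomial in jet-variables of sufficiently high order). $\mathcal{A}_H$ is the algebra of all differential invariants. An invariant derivation is a combination of total derivatives, with coefficients functions on a finite jet space, commuting with the prolonged action. Generation (Lie–Tresse sense) means: every element of the algebra is a rational expression in finitely many functions $\nabla_JI_i$, where $I_i$ are the listed invariants and $\nabla_J$ are iterated compositions of the listed derivations; differential syzygies are the relations among these functions. *)

(* Defs.v *)
From HB Require Import structures.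
From mathcomp Require Import all_boot all_order all_algebra.
From mathcomp Require Import finmap.
From mathcomp.multinomials Require Import monalg.
From mathcomp Require Import reals.

Set Implicit Arguments.
Unset Strict Implicit.
Unset Printing Implicit Defensive.

Import GRing.Theory Num.Theory.
Local Open Scope ring_scope.
Local Open Scope quotient_scope.

Local Notation "1" := (@mone _) : monom_scope.

(* Value at [v] of the monomial [m] in commuting variables indexed by [I]. *)
Section Subst.
Context (I : choiceType) (S : comNzRingType) (v : I -> S).

Definition meval (m : {cmonom I}) : S := \prod_(i <- finsupp m) v i ^+ m i.

Lemma mevalEw (d : {fset I}) (m : {cmonom I}) : (finsupp m `<=` d)%fset ->
  meval m = \prod_(i <- d) v i ^+ m i.
Proof.
move=> le; rewrite /meval (big_fset_incl _ le) // => i _.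
by move=> /fsfun_dflt ->; rewrite expr0.
Qed.

Lemma meval_is_multiplicative : mmorphism meval.
Proof.
split=> [m1 m2|]; last by rewrite /meval mdom1 big_seq_fset0.
rewrite (@mevalEw (finsupp m1 `|` finsupp m2)%fset) ?mdomD ?fsubset_refl //.
rewrite (@mevalEw (finsupp m1 `|` finsupp m2)%fset m1) ?fsubsetUl //.
rewrite (@mevalEw (finsupp m1 `|` finsupp m2)%fset m2) ?fsubsetUr //.
by rewrite -big_split; apply: eq_bigr => i _; rewrite cmM exprD.
Qed.

HB.instance Definition _ :=
  monalg.isMultiplicative.Build {cmonom I} S meval meval_is_multiplicative.
End Subst.

(* Polynomials in countably many variables over a domain form a domain: the
   Kronecker substitution X_i |-> X^(N^i) sends two given nonzero polynomials to
   nonzero univariate ones once N exceeds all their exponents. *)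
Section Domain.
Context (I : countType) (R : idomainType).
Implicit Types (m : {cmonom I}) (p q : {malg R[{cmonom I}]}).

Lemma digits_inj (N b : nat) (a a' : nat -> nat) :
    (forall k, a k < N)%N -> (forall k, a' k < N)%N ->
    (\sum_(k < b) a k * N ^ k = \sum_(k < b) a' k * N ^ k)%N ->
  forall k, (k < b)%N -> a k = a' k.
Proof.
elim: b a a' => [//|b IHb] a a' aN a'N.
have step (c : nat -> nat) : (\sum_(k < b.+1) c k * N ^ k =
    c 0 + (\sum_(k < b) c k.+1 * N ^ k) * N)%N.
  rewrite big_ord_recl expn0 muln1; congr addn; rewrite big_distrl /=.
  by apply: eq_bigr => i _; rewrite /bump /= add1n expnSr mulnA.
rewrite !step => e; have e0 : a 0%N = a' 0%N.
  by move/(congr1 (modn^~ N)): e; rewrite /= !(addnC (_ 0%N)) !modnMDl !modn_small.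
move: e; rewrite e0 => /addnI/eqP; rewrite eqn_mul2r.
have N0 : (0 < N)%N by apply: leq_ltn_trans (aN 0%N).
rewrite (gtn_eqF N0) /= => /eqP e [//|k] kb.
exact: (IHb (a \o S) (a' \o S) (fun k => aN k.+1) (fun k => a'N k.+1) e).
Qed.

Definition mwt (N : nat) m := (\sum_(i <- finsupp m) m i * N ^ choice.pickle i)%N.

Definition kron (N : nat) p : {poly R} :=
  mmap (@polyC R) (meval (fun i : I => 'X ^+ (N ^ choice.pickle i))) p.

Lemma kronM N : {morph kron N : p q / p * q}.
Proof. move=> p q; exact: rmorphM. Qed.

Lemma kron1 N : kron N 1 = 1.
Proof. exact: rmorph1. Qed.

Lemma kronE N p : kron N p = \sum_(m <- msupp p) p@_m *: 'X^(mwt N m).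
Proof.
rewrite /kron mmapE; apply: eq_bigr => m _; rewrite mul_polyC; congr (_ *: _).
rewrite /meval /mwt; elim/big_rec2: _ => [|i e s _ ->]; first by rewrite expr0.
by rewrite exprD -exprM mulnC.
Qed.

Definition digit m k := if choice.unpickle k is Some i
  then (if choice.pickle (i : I) == k then m i else 0%N) else 0%N.

Lemma digit_pickle m i : digit m (choice.pickle i) = m i.
Proof. by rewrite /digit choice.pickleK eqxx. Qed.

Lemma mwtE N b m : (forall i, i \in finsupp m -> choice.pickle i < b)%N ->
  mwt N m = (\sum_(k < b) digit m k * N ^ k)%N.
Proof.
move=> hb; rewrite /mwt (big_seq_fsetE _ _ predT) /=.
pose g (i : finsupp m) : 'I_b := Ordinal (hb (val i) (valP i)).
rewrite (bigID (mem [set g i | i : finsupp m])) /=.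
rewrite [X in (_ + X)%N]big1 ?addn0 => [|k]; last first.
  move=> hk; rewrite /digit; case E: (choice.unpickle k) => [i|//]; case: eqP => // ek.
  case: (finsuppP m i) => // him; case/negP: hk; apply/imsetP.
  by exists [` him]%fset => //; apply: val_inj; rewrite /= -ek.
rewrite big_imset /= => [|i j _ _ /(congr1 val)/= /(pcan_inj choice.pickleK)]; last first.
  exact: val_inj.
by apply: eq_bigr => i _; rewrite digit_pickle.
Qed.

Lemma mwt_inj N m m' : (forall i, m i < N)%N -> (forall i, m' i < N)%N ->
  mwt N m = mwt N m' -> m = m'.
Proof.
move=> mN m'N e.
pose b := (\max_(i <- (finsupp m `|` finsupp m')%fset) choice.pickle i).+1.
have hb i : i \in (finsupp m `|` finsupp m')%fset -> (choice.pickle i < b)%N.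
  by move=> hi; rewrite ltnS; apply: (@leq_bigmax_seq _ _ xpredT).
have hm i : i \in finsupp m -> (choice.pickle i < b)%N.
  by move=> h; apply: hb; rewrite in_fsetU h.
have hm' i : i \in finsupp m' -> (choice.pickle i < b)%N.
  by move=> h; apply: hb; rewrite in_fsetU h orbT.
have dN (n : {cmonom I}) : (forall i, n i < N)%N -> (0 < N)%N -> forall k, (digit n k < N)%N.
  by move=> nN N0 k; rewrite /digit; case: (choice.unpickle k) => // i; case: eqP.
apply/eqP/cmP => i.
have N0 : (0 < N)%N by apply: leq_ltn_trans (mN i).
have [hi|] := boolP (i \in (finsupp m `|` finsupp m')%fset); last first.
  by rewrite in_fsetU negb_or => /andP[/fsfun_dflt -> /fsfun_dflt ->].
move: e; rewrite (mwtE _ hm) (mwtE _ hm').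
move/(digits_inj (dN _ mN N0) (dN _ m'N N0))/(_ _ (hb _ hi)).
by rewrite !digit_pickle.
Qed.

Definition expbound p :=
  (\max_(m <- msupp p) \max_(i <- finsupp m) m i).+1.

Lemma expboundP p m i : m \in msupp p -> (m i < expbound p)%N.
Proof.
move=> hm; rewrite ltnS.
apply: (@leq_trans (\max_(j <- finsupp m) m j)).
  case: (finsuppP m i) => // him.
  exact: (@leq_bigmax_seq _ _ xpredT (fun j => m j)).
exact: (@leq_bigmax_seq _ _ xpredT (fun m : {cmonom I} => \max_(j <- finsupp m) m j)).
Qed.

Lemma coef_kron N p m : (expbound p <= N)%N -> m \in msupp p ->
  (kron N p)`_(mwt N m) = p@_m.
Proof.
move=> hN hm; rewrite kronE coef_sum.
rewrite (big_rem m) //= coefZ coefXn eqxx mulr1 big_seq big1 ?addr0 // => m'.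
rewrite (mem_rem_uniq _ (fset_uniq _)) inE => /andP[ne hm']; rewrite coefZ coefXn.
case: eqP => [e|]; last by rewrite mulr0.
case/eqP: ne; apply/esym/(@mwt_inj N) => // i.
  exact: leq_trans (expboundP _ hm) hN.
exact: leq_trans (expboundP _ hm') hN.
Qed.

Lemma kron_neq0 N p : p != 0 -> (expbound p <= N)%N -> kron N p != 0.
Proof.
rewrite -msupp_eq0 => /fset0Pn[m hm] hN; apply/eqP => k0.
move: (coef_kron hN hm); rewrite k0 coef0 => /esym/eqP.
by rewrite mcoeff_eq0 hm.
Qed.

Lemma malg_idomain p q : p * q = 0 -> (p == 0) || (q == 0).
Proof.
move=> pq0; apply/norP => -[p0 q0].
pose N := maxn (expbound p) (expbound q).
have := kronM N p q; rewrite pq0 /kron raddf0 => /esym/eqP.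
by rewrite mulf_eq0; apply/negP/norP; split; apply: kron_neq0;
  rewrite ?leq_maxl ?leq_maxr.
Qed.

Definition malg_unit : pred {malg R[{cmonom I}]} :=
  fun p => (p == (p@_1%M)%:MP) && (p@_1%M \is a GRing.unit).
Definition malg_inv p := if malg_unit p then ((p@_1%M)^-1)%:MP else p.

Lemma malg_mulVp : {in malg_unit, left_inverse 1 malg_inv *%R}.
Proof.
move=> p hp; rewrite /malg_inv ifT //; case/andP: hp.
move: (p@_1%M) => c /eqP -> cu.
by rewrite -(@mpolyCM {cmonom I} R) (mulVr cu).
Qed.

Lemma malg_invp_out : {in [predC malg_unit], malg_inv =1 id}.
Proof.
by move=> p hp; rewrite /malg_inv ifF //; apply/negbTE.
Qed.

Lemma malg_constP p q : q * p = 1 -> p = (p@_1%M)%:MP.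
Proof.
move=> qp1.
pose N := maxn (maxn (expbound p) (expbound q)) 1%N.
have hN : (expbound p <= N)%N by rewrite /N !leq_max leqnn.
have sz : size (kron N p) = 1%N.
  have := kronM N q p; rewrite qp1 kron1 => /esym e.
  have /eqP := congr1 (fun r : {poly R} => size r) e.
  rewrite size_poly1 => /eqP; move/eqP; rewrite size_mul_eq1.
  by case/andP => _ /eqP.
apply/malgP => m; rewrite mcoeffC.
case: (boolP (m \in msupp p)) => hm; last first.
  rewrite (mcoeff_outdom hm); case: (eqVneq m 1%M) => [e|]; last by rewrite mulr0n.
  by rewrite -e (mcoeff_outdom hm).
have w0 : mwt N m = 0%N.
  apply/eqP; move: (coef_kron hN hm); apply: contra_eqT; rewrite -lt0n => w.
  by rewrite nth_default ?sz // eq_sym mcoeff_eq0 hm.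
have -> : m = 1%M.
  apply: (@mwt_inj N) => [i|i|]; first exact: leq_trans (expboundP _ hm) hN.
    by rewrite cm1 /N leq_max orbT.
  by rewrite w0 /mwt mdom1 big_seq_fset0.
by rewrite eqxx.
Qed.

Lemma malg_unitPl p q : q * p = 1 -> malg_unit p.
Proof.
move=> qp1; have pq1 : p * q = 1 by rewrite [LHS](@mulrC _ p q).
move: (malg_constP qp1) (malg_constP pq1); rewrite /malg_unit.
move: (p@_1%M) (q@_1%M) => a b ep eq.
rewrite ep eqxx; apply/unitrPr; exists b.
have e1 : (a * b)%:MP = p * q.
  transitivity (a%:MP * b%:MP : {malg R[{cmonom I}]}); first exact: mpolyCM.
  by rewrite ep eq.
by have := congr1 (mcoeff 1%M) e1; rewrite malgCK pq1 mcoeff1 eqxx.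
Qed.

HB.instance Definition _ :=
  GRing.ComNzRing_hasMulInverse.Build (malg {cmonom I} R)
    malg_mulVp malg_unitPl malg_invp_out.
HB.instance Definition _ :=
  GRing.ComUnitRing_isIntegral.Build (malg {cmonom I} R) malg_idomain.
End Domain.

(* The derivation of the polynomial algebra, R-linear, with X_i |-> v i. *)
Definition poly_der (I : choiceType) (R : comNzRingType)
    (v : I -> {malg R[{cmonom I}]}) (p : {malg R[{cmonom I}]}) :
    {malg R[{cmonom I}]} :=
  \sum_(m <- msupp p) \sum_(i <- finsupp m)
    (p@_m *+ m i) *: (<< divcm m (ucm i) >> * v i).

(* Coordinates on the space of infinite jets: [inl 0] and [inl 1] are x and y,
   [inr (i, j)] is the derivative of u, i times in x and j times in y.  A
   polynomial, hence a rational function, involves finitely many of them, i.e.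
   lives on some J^k(V). *)
Definition coord : countType := ('I_2 + nat * nat)%type.

Notation jetpoly R := {malg R[{cmonom coord}]}.
Notation jetrat R := {fraction {malg R[{cmonom coord}]}}.

Local Notation "x %:F" := (@FracField.tofrac _ x).

Section Jets.
Context (R : realType).
Implicit Types (p q : jetpoly R) (f g : jetrat R).

Definition var (c : coord) : jetpoly R := << ucm c >>.

Definition jet : Type := ('cV[R]_2 * (nat -> nat -> R))%type.

Definition jet_coord (t : jet) (c : coord) : R :=
  match c with inl a => t.1 a 0 | inr (i, j) => t.2 i j end.

Definition jet_eval (t : jet) (p : jetpoly R) : R :=
  mmap idfun (meval (jet_coord t)) p.

(* [f] is regular at [t], where it takes the value [v]. *)
Definition has_value (f : jetrat R) (t : jet) (v : R) : Prop :=
  exists p q, [/\ jet_eval t q != 0, f = p%:F / q%:F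
                & v = jet_eval t p / jet_eval t q].

Definition total_der (a : 'I_2) : jetpoly R -> jetpoly R :=
  poly_der (fun c : coord => match c with
    | inl b => (a == b)%:R
    | inr (i, j) => var (inr (if a == 0 then (i.+1, j) else (i, j.+1)))
    end).

(* Quotient rule; the result does not depend on the chosen fraction. *)
Definition total_derF (a : 'I_2) (f : jetrat R) : jetrat R :=
  let n := \n_(repr f) in let d := \d_(repr f) in
  (total_der a n * d - n * total_der a d)%:F / (d ^+ 2)%:F.

(* The pair (a, b) stands for a D_x + b D_y. *)
Definition derivation : Type := (jetrat R * jetrat R)%type.

Definition apply_der (nab : derivation) (f : jetrat R) : jetrat R :=
  nab.1 * total_derF 0 f + nab.2 * total_derF 1 f.

Definition scale_der (f : jetrat R) (nab : derivation) : derivation :=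
  (f * nab.1, f * nab.2).

Definition omega (v w : 'cV[R]_2) : R := v 0 0 * w 1 0 - v 1 0 * w 0 0.

(* An element of ACSp(2, R) = (Sp(2, R) x R_+) |x R^2. *)
Record acsp := Acsp {
  sp_part : 'M[R]_2;
  dilation : R;
  translation : 'cV[R]_2;
  sp_partP : forall v w, omega (sp_part *m v) (sp_part *m w) = omega v w;
  dilationP : 0 < dilation
}.

Definition lin (h : acsp) : 'M[R]_2 := dilation h *: sp_part h.

Definition act (h : acsp) (v : 'cV[R]_2) : 'cV[R]_2 := lin h *m v + translation h.

(* With (X, Y) = h(x, y), the chain rule gives the operators D_X, D_Y of total
   derivation along the new coordinates in terms of D_x, D_y. *)
Definition new_der (h : acsp) (a : 'I_2) (p : jetpoly R) : jetpoly R :=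
  \sum_b invmx (lin h) b a *: total_der b p.

(* The derivatives of u \o h^-1 at h(x, y): since h fixes the values of u, these
   are the D_X^i D_Y^j u. *)
Definition new_u (h : acsp) (i j : nat) : jetpoly R :=
  iter i (new_der h 0) (iter j (new_der h 1) (var (inr (0%N, 0%N)))).

(* The prolonged action: the jet of u at v goes to the jet of u \o h^-1 at h v. *)
Definition prolong (h : acsp) (t : jet) : jet :=
  (act h t.1, fun i j => jet_eval t (new_u h i j)).

(* Composition with [prolong h], on polynomials and on rational functions. *)
Definition pullback (h : acsp) (p : jetpoly R) : jetpoly R :=
  mmap (fun c => c%:MP) (meval (fun c : coord => match c with
    | inl a => \sum_b lin h a b *: var (inl b) + (translation h a 0)%:MP
    | inr (i, j) => new_u h i j
    end)) p.

Lemma jet_eval_pullback h t p :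
  jet_eval t (pullback h p) = jet_eval (prolong h t) p.
Proof.
rewrite /pullback mmapE /jet_eval raddf_sum [RHS]mmapE; apply: eq_bigr => m _.
rewrite /= rmorphM /=; congr (_ * _); first by rewrite /= mmapC.
rewrite /= [X in mmap _ _ X = _]/meval rmorph_prod /=.
apply: eq_bigr => -[a|[i j]] _; rewrite rmorphXn //=; congr (_ ^+ _).
rewrite /act !mxE rmorphD raddf_sum /=; congr (_ + _); last by rewrite mmapC.
apply: eq_bigr => b _; rewrite (mmapZ (f := idfun)); congr (_ * _).
by rewrite mmapU mul1r /= /meval mdomU big_seq_fset1 cmUU expr1.
Qed.
Definition pullbackF (h : acsp) (f : jetrat R) : jetrat R :=
  (pullback h \n_(repr f))%:F / (pullback h \d_(repr f))%:F.

(* Constancy on orbits, wherever the rational function is regular. *)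
Definition diff_invariant (f : jetrat R) : Prop :=
  forall h t v w, has_value f t v -> has_value f (prolong h t) w -> w = v.

Definition invariant_derivation (nab : derivation) : Prop :=
  forall h f, pullbackF h (apply_der nab f) = apply_der nab (pullbackF h f).

Section Generation.
Context (n m : nat) (gens : 'I_n -> jetrat R) (ders : 'I_m -> derivation).

(* The iterated composition along the word [J], applied to [f]. *)
Definition iter_der (J : seq 'I_m) (f : jetrat R) : jetrat R :=
  foldr (fun j => apply_der (ders j)) f J.

(* Polynomials in the formal symbols (i, J), which stand for nabla_J I_i. *)
Notation formal := {malg R[{cmonom ('I_n * seq 'I_m)%type}]}.

Definition realize (P : formal) : jetrat R :=
  mmap (fun c : R => (c%:MP : jetpoly R)%:F)
    (meval (fun s : 'I_n * seq 'I_m => iter_der s.2 (gens s.1))) P.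

Definition rational_expr (f : jetrat R) : Prop :=
  exists P Q : formal, realize Q != 0 /\ f = realize P / realize Q.

Definition formal_der (j : 'I_m) : formal -> formal :=
  poly_der (fun s : 'I_n * seq 'I_m => << ucm (s.1, j :: s.2) >>).

(* The differential ideal generated by [Rl]. *)
Definition diff_ideal (Rl : formal -> Prop) (P : formal) : Prop :=
  forall K : formal -> Prop,
    K 0 -> (forall A B, K A -> K B -> K (A + B)) ->
    (forall A B, K B -> K (A * B)) -> (forall j A, K A -> K (formal_der j A)) ->
    (forall A, Rl A -> K A) -> K P.

(* A = < gens ; ders | Rl >.  The syzygies are the polynomial relations among
   the functions nabla_J I_i, and Rl generates them. *)
Definition lie_tresse (A : jetrat R -> Prop) (Rl : formal -> Prop) : Prop :=
  [/\ forall i, A (gens i),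
      forall j, invariant_derivation (ders j),
      forall f, A f <-> rational_expr f
    & forall P, realize P = 0 <-> diff_ideal Rl P].
End Generation.

Definition u_ (i j : nat) : jetrat R := (var (inr (i, j)))%:F.
Notation u_x := (u_ 1 0).
Notation u_y := (u_ 0 1).
Notation u_xx := (u_ 2 0).
Notation u_xy := (u_ 1 1).
Notation u_yy := (u_ 0 2).

Definition I0 : jetrat R := u_ 0 0.
Definition I2' : jetrat R := u_xx * u_yy - u_xy ^+ 2.

Definition nabla1' : derivation :=
  (u_x * u_yy - u_y * u_xy, - (u_x * u_xy - u_y * u_xx)).
Definition nabla2 : derivation := (- u_y, u_x).

Definition nabla1'' : derivation := scale_der (1 / I2') nabla1'.
Definition nabla2'' : derivation := scale_der (I2' / apply_der nabla2 I2') nabla2.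

Definition I3a'' : jetrat R := apply_der nabla1' I2' / I2' ^+ 2.
Definition I3b'' : jetrat R := apply_der nabla2 I2' ^+ 2 / I2' ^+ 3.

End Jets.

(* Main.v *)
(* The frame e_1 = H^-1 grad u, e_2 = J grad u / delta, where H is the Hessian of u,
   Delta = det H and delta = nabla_2(Delta) / Delta, consists of the two invariant
   derivations.  Its flat connection coefficients are rational in the generators and
   their derivatives: this comes down to s := e_1(u) = H(e_1, e_1), H(e_1, e_2) = 0,
   H(e_2, e_2) = s / I_3b and to the identities e_1(Delta) / Delta = I_3a,
   e_2(Delta) / Delta = 1, I_3b = delta^2 / Delta.  Hence, by induction on the order,
   so are all components of the derivatives of u in this frame.

   A rational invariant f = p / q satisfies p(x', G u) q(x, u) = p(x, u) q(x', G u) for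
   all x' and all matrices G of positive determinant, hence formally, with independent
   variables for x' and the entries of G.  Substituting for x' a constant vector and for
   G the frame multiplied by a constant matrix, chosen such that q does not vanish,
   expresses f through the components above.  Using a constant multiple of the frame
   rather than the frame itself spares any discussion of common factors of p and q. *)
Require Import Defs.
From HB Require Import structures.
From mathcomp Require Import all_boot all_order all_algebra.
From mathcomp Require Import finmap.
From mathcomp.multinomials Require Import monalg.
From mathcomp Require Import reals.
From mathcomp Require Import ring lra.

Set Implicit Arguments.
Unset Strict Implicit.
Unset Printing Implicit Defensive.

Import Order.TTheory GRing.Theory Num.Theory.
Local Open Scope ring_scope.

Local Notation "1" := (@mone _) : monom_scope.
Local Notation "m * m'" := (mmul m m') : monom_scope.

Lemma sum_I2 (V : nmodType) (E : 'I_2 -> V) : \sum_i E i = E 0 + E 1.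
Proof.
rewrite 2!big_ord_recl big_ord0 addr0; congr (_ + E _); exact: val_inj.
Qed.

(** * Linear substitutions in the derivatives of u *)

Section Twist.
Context (S : comNzRingType).
Implicit Types (G : 'M[S]_2) (W U : nat -> nat -> S).

Definition shift G (a : 'I_2) W k l : S := G 0 a * W k.+1 l + G 1 a * W k l.+1.

(* With [U i j] the derivatives of [u], these are the iterated derivatives of [u]
   along the columns of [G], the entries of [G] being treated as constants. *)
Definition twist G U i j : S :=
  iter i (shift G 0) (iter j (shift G 1) U) 0%N 0%N.

Lemma shiftE G a W k l :
  shift G a W k l = G 0 a * W k.+1 l + G 1 a * W k l.+1.
Proof. by []. Qed.

Lemma shift_ext G a W W' : W =2 W' -> shift G a W =2 shift G a W'.
Proof. by move=> e k l; rewrite /shift !e. Qed.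

Lemma iter_shift_ext G a n W W' :
  W =2 W' -> iter n (shift G a) W =2 iter n (shift G a) W'.
Proof. by move=> e; elim: n => //= n IHn; apply: shift_ext. Qed.

Lemma shiftC G a b W : shift G a (shift G b W) =2 shift G b (shift G a W).
Proof. move=> k l; rewrite /shift; ring. Qed.

Lemma iter_shiftC G a b n W :
  iter n (shift G a) (shift G b W) =2 shift G b (iter n (shift G a) W).
Proof.
elim: n => //= n IHn k l.
by rewrite (shift_ext _ _ IHn) shiftC.
Qed.

Lemma twist_ext G U U' : U =2 U' -> twist G U =2 twist G U'.
Proof. by move=> e i j; do 2![apply: iter_shift_ext]. Qed.

Lemma twistSl G U i j : twist G U i.+1 j = twist G (shift G 0 U) i j.
Proof.
rewrite /twist iterSr; apply: iter_shift_ext => k l.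
by rewrite -iter_shiftC.
Qed.

Lemma twistSr G U i j : twist G U i j.+1 = twist G (shift G 1 U) i j.
Proof. by rewrite /twist iterSr. Qed.

Lemma twist_linear G U U' a b i j :
  twist G (fun k l => a * U k l + b * U' k l) i j =
  a * twist G U i j + b * twist G U' i j.
Proof.
have lin c n V V' : iter n (shift G c) (fun k l => a * V k l + b * V' k l) =2
    (fun k l => a * iter n (shift G c) V k l + b * iter n (shift G c) V' k l).
  by elim: n => //= n IHn k l; rewrite (shift_ext _ _ IHn) /shift; ring.
by rewrite /twist (iter_shift_ext _ _ _ (lin _ _ _ _)) lin.
Qed.

(** Linearity of [twist G], with [twistSl] and [twistSr], lets a shift after the twist be absorbed
    as a shift before it, along a column of the product matrix. *)
Lemma shift_twist G G' c U :
  shift G' c (twist G U) =2 twist G (shift (G *m G') c U).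
Proof.
move=> k l; rewrite {1}/shift twistSl twistSr -twist_linear.
by apply: twist_ext => i j; rewrite /shift !mxE !sum_I2; ring.
Qed.

(** The chain rule for two successive linear changes of variables. It inverts the prolonged action
    in [prolong_surj] and reduces constant multiples of the frame to the frame itself in
    [invariant_generated]. *)
Lemma twistM G G' U : twist G' (twist G U) =2 twist (G *m G') U.
Proof.
have e c n V : iter n (shift G' c) (twist G V) =2
    twist G (iter n (shift (G *m G') c) V).
  elim: n => //= n IHn k l.
  by rewrite (shift_ext _ _ IHn) shift_twist.
by move=> i j; rewrite /twist (iter_shift_ext _ _ _ (e _ _ _)) e.
Qed.

Lemma twist1 U : twist 1%:M U =2 U.
Proof.
have e0 n V : iter n (shift 1%:M 0) V =2 fun k l => V (n + k)%N l.
  elim: n V => //= n IHn V k l; rewrite /shift !IHn !mxE /= mul1r mul0r addr0.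
  by rewrite addnS.
have e1 n V : iter n (shift 1%:M 1) V =2 fun k l => V k (n + l)%N.
  elim: n V => //= n IHn V k l; rewrite /shift !IHn !mxE /= mul1r mul0r add0r.
  by rewrite addnS.
by move=> i j; rewrite /twist e0 e1 !addn0.
Qed.
End Twist.

Lemma twist_map (S S' : comNzRingType) (phi : {rmorphism S -> S'}) G U i j :
  phi (twist G U i j) = twist (map_mx phi G) (fun k l => phi (U k l)) i j.
Proof.
have e c n (V : nat -> nat -> S) k l : phi (iter n (shift G c) V k l) =
    iter n (shift (map_mx phi G) c) (fun k l => phi (V k l)) k l.
  elim: n k l => //= n IHn k l; rewrite shiftE rmorphD !rmorphM !IHn.
  by rewrite shiftE !mxE.
by rewrite /twist e; apply: iter_shift_ext => k l; rewrite e.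
Qed.

Lemma det_mx2 (S : comNzRingType) (A : 'M[S]_2) :
  \det A = A 0 0 * A 1 1 - A 0 1 * A 1 0.
Proof.
rewrite (expand_det_row _ 0) sum_I2 /cofactor !det_mx11 !mxE /=.
rewrite expr0 expr1 mul1r mulN1r mulrN.
by congr (_ * A _ _ - _ * A _ _); apply: val_inj.
Qed.

(** * Derivations and subfields of an abstract field *)

Section Derivations.
Context (F : fieldType).

Definition is_der (d : F -> F) : Prop :=
  (forall x y, d (x - y) = d x - d y) /\
  (forall x y, d (x * y) = d x * y + x * d y).

Context (d : F -> F) (dP : is_der d).

Lemma derB x y : d (x - y) = d x - d y.
Proof. by case: dP. Qed.

Lemma derM x y : d (x * y) = d x * y + x * d y.
Proof. by case: dP. Qed.

Lemma der0 : d 0 = 0.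
Proof. by rewrite -[X in d X](subrr 0) derB subrr. Qed.

Lemma derN x : d (- x) = - d x.
Proof. by rewrite -[- x]add0r derB der0 add0r. Qed.

Lemma derD x y : d (x + y) = d x + d y.
Proof. by rewrite -[y in LHS]opprK derB derN opprK. Qed.

Lemma der1 : d 1 = 0.
Proof.
by apply: (addIr (d 1)); rewrite add0r -[in RHS](mulr1 1) derM mulr1 mul1r.
Qed.

Lemma derX2 x : d (x ^+ 2) = 2 * x * d x.
Proof. rewrite expr2 derM; ring. Qed.


Lemma derV x : x != 0 -> d x^-1 = - d x / x ^+ 2.
Proof.
move=> x0; apply: (mulIf x0); apply: (addIr (x^-1 * d x)).
by rewrite -derM mulVf // der1; field.
Qed.

Lemma der_div x y : y != 0 -> d (x / y) = (d x * y - x * d y) / y ^+ 2.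
Proof. by move=> y0; rewrite derM derV //; field. Qed.
End Derivations.

Lemma is_der_lin (F : fieldType) (d d' : F -> F) (a b : F) :
  is_der d -> is_der d' -> is_der (fun f => a * d f + b * d' f).
Proof.
move=> dP dP'; split=> x y.
  by rewrite (derB dP) (derB dP'); ring.
by rewrite (derM dP) (derM dP'); ring.
Qed.

Section Subfield.
Context (F : fieldType).

(** The predicate of a subfield. Quotients by 0 are included: they are 0, which lies in every
    subfield. *)
Definition field_closed (K : F -> Prop) : Prop :=
  [/\ K 1, forall x y, K x -> K y -> K (x - y)
    & forall x y, K x -> K y -> K (x / y)].

Context (K : F -> Prop) (KP : field_closed K).

Lemma fc1 : K 1. Proof. by case: KP. Qed.
Lemma fcB x y : K x -> K y -> K (x - y). Proof. by case: KP => _ + _; apply. Qed.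
Lemma fc_div x y : K x -> K y -> K (x / y). Proof. by case: KP => _ _; apply. Qed.
Lemma fc0 : K 0. Proof. by rewrite -(subrr 1); apply: fcB; apply: fc1. Qed.
Lemma fcN x : K x -> K (- x).
Proof. by rewrite -sub0r; apply: fcB; apply: fc0. Qed.
Lemma fcD x y : K x -> K y -> K (x + y).
Proof. by move=> Kx Ky; rewrite -[y]opprK; apply: fcB => //; apply: fcN. Qed.
Lemma fcV x : K x -> K x^-1.
Proof. by rewrite -div1r; apply: fc_div; apply: fc1. Qed.
Lemma fcM x y : K x -> K y -> K (x * y).
Proof. by move=> Kx Ky; rewrite -[y]invrK; apply: fc_div => //; apply: fcV. Qed.
Lemma fc_nat n : K n%:R.
Proof.
by elim: n => [|n IHn]; rewrite ?mulrS; [apply: fc0|apply: fcD IHn; apply: fc1].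
Qed.
Lemma fc_shift (G : 'M_2) a W : (forall i j, K (G i j)) -> (forall k l, K (W k l)) ->
  forall k l, K (shift G a W k l).
Proof. by move=> KG KW k l; apply: fcD; apply: fcM. Qed.
Lemma fc_twist (G : 'M_2) U : (forall i j, K (G i j)) -> (forall k l, K (U k l)) ->
  forall i j, K (twist G U i j).
Proof.
move=> KG KU i j.
have it a n W : (forall k l, K (W k l)) -> forall k l, K (iter n (shift G a) W k l).
  by move=> KW; elim: n => //= n IHn; apply: fc_shift.
by do 2![apply: (it)].
Qed.
End Subfield.

(** * The moving frame *)

Section Frame.
Context (F : fieldType) (D0 D1 : F -> F) (D0P : is_der D0) (D1P : is_der D1).
Context (U : nat -> nat -> F).
Hypotheses (D0U : forall i j, D0 (U i j) = U i.+1 j).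
Hypotheses (D1U : forall i j, D1 (U i j) = U i j.+1).

Definition vf (w : F * F) (f : F) : F := w.1 * D0 f + w.2 * D1 f.

Lemma vf_der w : is_der (vf w).
Proof. exact: is_der_lin. Qed.

(** The quantities of the theorem, copied to an arbitrary field with two derivations, where the
    identities are computed. On jets both versions agree by conversion: see [hess_def] and the
    lemmas after it. *)
Definition hess : F := U 2 0 * U 0 2 - U 1 1 ^+ 2.
Definition vf1 : F * F :=
  (U 1 0 * U 0 2 - U 0 1 * U 1 1, - (U 1 0 * U 1 1 - U 0 1 * U 2 0)).
Definition vf2 : F * F := (- U 0 1, U 1 0).
Definition inv3a : F := vf vf1 hess / hess ^+ 2.
Definition inv3b : F := vf vf2 hess ^+ 2 / hess ^+ 3.
Definition frame1 : F * F := (1 / hess * vf1.1, 1 / hess * vf1.2).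
Definition frame2 : F * F :=
  (hess / vf vf2 hess * vf2.1, hess / vf vf2 hess * vf2.2).
Definition frame (a : 'I_2) : F * F := if a == 0 then frame1 else frame2.
Definition frame_mx : 'M[F]_2 :=
  \matrix_(b, a) (if b == 0 then (frame a).1 else (frame a).2).

(** The Hessian form evaluated at [vf2], which is also the numerator of the curvature of the level
    curves of u. The frame degenerates where it vanishes. *)
Definition hess2 : F := vf vf1 (U 0 0).

Hypotheses (hess0 : hess != 0) (dhess0 : vf vf2 hess != 0) (hess20 : hess2 != 0).
Hypothesis two0 : 2%:R != 0 :> F.

Lemma hess2E : hess2 = U 1 0 * (U 1 0 * U 0 2 - U 0 1 * U 1 1) -
  U 0 1 * (U 1 0 * U 1 1 - U 0 1 * U 2 0).
Proof. rewrite /hess2 /vf D0U D1U /=; ring. Qed.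

Lemma dhessE : vf vf2 hess =
  - U 0 1 * (U 3 0 * U 0 2 + U 2 0 * U 1 2 - (U 1 1 * U 2 1 + U 1 1 * U 2 1)) +
  U 1 0 * (U 2 1 * U 0 2 + U 2 0 * U 0 3 - (U 1 1 * U 1 2 + U 1 1 * U 1 2)).
Proof.
rewrite /vf /hess (derB D0P) (derB D1P) (derM D0P) (derM D1P) (derX2 D0P) (derX2 D1P).
rewrite !D0U !D1U /=; ring.
Qed.

Lemma det_frame_mx : \det frame_mx != 0.
Proof.
suff -> : \det frame_mx = hess2 / vf vf2 hess.
  by rewrite mulf_neq0 // invr_neq0.
rewrite det_mx2 !mxE /= hess2E; move: dhess0 hess0.
move: (vf _ _) => d; rewrite /vf1 /vf2 /= => *; field; exact/andP.
Qed.

(* The logarithmic derivative of [vf vf2 hess / hess] along the frame: see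
   [der_ratioE]. *)
Definition der_ratio (a : 'I_2) : F :=
  (vf (frame a) inv3b / inv3b + (if a == 0 then inv3a else 1)) / 2%:R.

(* The flat connection in the moving frame, in terms of the generators: [connE].
   Since the frame has entries of order three, a priori these are invariants of
   order four. *)
Definition conn (c a d : 'I_2) : F :=
  let s := vf frame1 (U 0 0) in
  if a == 0 then
    if c == 0 then
      (if d == 0 then vf frame1 s / s - 1 else vf frame2 s * inv3b / s)
    else (if d == 0 then vf frame2 s / s else 3%:R - vf frame1 s / s - inv3a)
  else
    if c == 0 then (if d == 0 then 0 else 1 - der_ratio 0)
    else (if d == 0 then - inv3b^-1 else - der_ratio 1).

Let s := vf frame1 (U 0 0).
Let del := vf vf2 hess / hess.

Lemma del0 : del != 0.
Proof. by rewrite mulf_neq0 // invr_neq0. Qed.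

Lemma inv3bE : inv3b = del ^+ 2 / hess.
Proof. by rewrite /inv3b /del; field. Qed.

Lemma vf_frame1 f : vf frame1 f = vf vf1 f / hess.
Proof. by rewrite /frame1 /vf /=; field. Qed.

Lemma vf_frame2 f : vf frame2 f = vf vf2 f / del.
Proof.
rewrite /frame2 /del [LHS]/vf [vf _ f]/vf /=.
by move: dhess0 hess0; move: (vf _ _) => d d0 h0; field; apply/andP.
Qed.

(** Logarithmic derivatives in I_3b = delta^2 / Delta: twice that of delta is that of I_3b plus that
    of Delta, and the latter is I_3a along e_1 and 1 along e_2. *)
Lemma der_ratioE a : der_ratio a = vf (frame a) del / del.
Proof.
rewrite /der_ratio.
have -> : (if a == 0 then inv3a else 1) = vf (frame a) hess / hess.
  rewrite /frame; case: ifP => _; first by rewrite vf_frame1 /inv3a; field.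
  by rewrite vf_frame2 /del; field; apply/andP.
have h := vf_der (frame a).
rewrite inv3bE (der_div h) // (derX2 h).
move: del0 hess0 two0; move: del hess (vf _ _) (vf _ _) => d e x y *.
by field; apply/and3P.
Qed.

Let der0E := ((derB D0P), (derN D0P), (derM D0P), (derX2 D0P), D0U).
Let der1E := ((derB D1P), (derN D1P), (derM D1P), (derX2 D1P), D1U).

Lemma frame_mxE b : frame_mx b 0 = (if b == 0 then vf1.1 else vf1.2) / hess.
Proof. by rewrite mxE /=; case: (b == 0); rewrite div1r mulrC. Qed.

Lemma frame_mxE' b : frame_mx b 1 = (if b == 0 then vf2.1 else vf2.2) / del.
Proof.
rewrite mxE /= /del; case: (b == 0); move: dhess0 hess0; move: (vf _ _) => *;
  field; exact/andP.
Qed.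

Lemma I2_cases (P : 'I_2 -> Prop) : P 0 -> P 1 -> forall b, P b.
Proof.
move=> P0 P1 [[|[|//]] h]; first by rewrite (_ : Ordinal h = 0) //; apply: val_inj.
by rewrite (_ : Ordinal h = 1) //; apply: val_inj.
Qed.

Lemma sE : s = hess2 / hess.
Proof. by rewrite /s vf_frame1. Qed.

(** Write C for the cubic form of third derivatives and N_c for the derivative along e_c.
    Differentiating s = e_1(u) gives H(N_c e_1, e_1) = e_c(s) - H(e_c, e_1). Differentiating H e_1 =
    grad u gives H(N_c e_1, w) = H(e_c, w) - C(e_c, e_1, w), so that H(N_1 e_1, e_2) = H(N_2 e_1,
    e_1) = e_2(s) by symmetry of C. Dividing by H(e_1, e_1) = s and H(e_2, e_2) = s / I_3b yields
    the coefficients. *)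
Lemma conn1 b : vf frame1 (frame_mx b 0) =
  conn 0 0 0 * frame_mx b 0 + conn 0 0 1 * frame_mx b 1.
Proof.
rewrite /conn /= inv3bE -/s !vf_frame1 vf_frame2 sE frame_mxE frame_mxE'.
(* Here delta cancels, which leaves an identity between derivatives of u of order at most three. *)
have -> : (vf vf1 (hess2 / hess) / hess / (hess2 / hess) - 1) * 
  ((if b == 0 then vf1.1 else vf1.2) / hess) +
  vf vf2 (hess2 / hess) / del * (del ^+ 2 / hess) / (hess2 / hess) *
  ((if b == 0 then vf2.1 else vf2.2) / del) =
  (vf vf1 (hess2 / hess) / hess2 - 1) * 
  ((if b == 0 then vf1.1 else vf1.2) / hess) +
  vf vf2 (hess2 / hess) / hess2 * (if b == 0 then vf2.1 else vf2.2).
  by field; rewrite hess20 hess0 del0.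
move: hess0 hess20 => h0 h20; have h2 := hess2E.
move: b; apply: I2_cases => /=; rewrite /vf !(der_div D0P) // !(der_div D1P) //.
  move: h0 h20; rewrite h2 /hess !der0E !der1E /= => h0 h20.
  by field; rewrite h0 h20.
move: h0 h20; rewrite h2 /hess !der0E !der1E /= => h0 h20.
by field; rewrite h0 h20.
Qed.

(** With the notation for [conn1], the coefficient of e_2 is 1 - C(e_1, e_2, e_2) / H(e_2, e_2). The
    trace of H^-1 N_1 H, which is e_1(Delta) / Delta = I_3a, equals C(e_1, e_1, e_1) / s + C(e_1,
    e_2, e_2) / H(e_2, e_2), and C(e_1, e_1, e_1) = 2 s - e_1(s). *)
Lemma conn2 b : vf frame2 (frame_mx b 0) =
  conn 1 0 0 * frame_mx b 0 + conn 1 0 1 * frame_mx b 1.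
Proof.
rewrite /conn /= -/s !vf_frame1 !vf_frame2 sE frame_mxE frame_mxE' /inv3a.
have -> : vf vf2 (hess2 / hess) / del / (hess2 / hess) * 
  ((if b == 0 then vf1.1 else vf1.2) / hess) +
  (3 - vf vf1 (hess2 / hess) / hess / (hess2 / hess) - vf vf1 hess / hess ^+ 2) *
  ((if b == 0 then vf2.1 else vf2.2) / del) =
  (vf vf2 (hess2 / hess) / hess2 * 
  (if b == 0 then vf1.1 else vf1.2) +
  (3 - vf vf1 (hess2 / hess) / hess2 - vf vf1 hess / hess ^+ 2) *
  (if b == 0 then vf2.1 else vf2.2)) / del.
  by field; rewrite hess20 hess0 del0.
congr (_ / _).
move: hess0 hess20 => h0 h20; have h2 := hess2E.
move: b; apply: I2_cases => /=; rewrite /vf !(der_div D0P) // !(der_div D1P) //.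
  move: h0 h20; rewrite h2 /hess !der0E !der1E /= => h0 h20.
  by field; rewrite h0 h20.
move: h0 h20; rewrite h2 /hess !der0E !der1E /= => h0 h20.
by field; rewrite h0 h20.
Qed.

(** The derivative of J grad u along w is J H w, which for w = e_1 is J grad u again; the factor 1 /
    delta contributes the rest. *)
Lemma conn3 b : vf frame1 (frame_mx b 1) =
  conn 0 1 0 * frame_mx b 0 + conn 0 1 1 * frame_mx b 1.
Proof.
rewrite /conn /= der_ratioE frame_mxE frame_mxE' mul0r add0r.
rewrite (der_div (vf_der _)) ?del0 // /frame /=.
have -> : vf frame1 (if b == 0 then vf2.1 else vf2.2) = if b == 0 then vf2.1 else vf2.2.
  rewrite vf_frame1; move: b hess0; rewrite /hess => + h0; apply: I2_cases => /=;
  rewrite /vf !der0E !der1E /=; by field.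
by rewrite /=; move: del0 (vf _ _) => d0 y; case: (b == 0); field.
Qed.

(** As for [conn3], now with J H J = - Delta H^-1, which turns J H e_2 into - [vf1] / delta. *)
Lemma conn4 b : vf frame2 (frame_mx b 1) =
  conn 1 1 0 * frame_mx b 0 + conn 1 1 1 * frame_mx b 1.
Proof.
rewrite /conn /= der_ratioE frame_mxE frame_mxE'.
rewrite (der_div (vf_der _)) ?del0 // /frame /= inv3bE.
have -> : vf frame2 (if b == 0 then vf2.1 else vf2.2) =
    - (if b == 0 then vf1.1 else vf1.2) / del.
  rewrite vf_frame2; congr (_ / _); move: b; apply: I2_cases => /=;
  rewrite /vf !der0E !der1E /=; ring.
by rewrite /=; move: del0 hess0 (vf _ _) => d0 h0 y; case: (b == 0); field; rewrite d0 h0.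
Qed.

Lemma connE c a b : vf (frame c) (frame_mx b a) =
  conn c a 0 * frame_mx b 0 + conn c a 1 * frame_mx b 1.
Proof.
move: c a; apply: I2_cases; apply: I2_cases.
- exact: conn1.
- exact: conn3.
- exact: conn2.
- exact: conn4.
Qed.

(** The array whose entry at (0, 0) is the twist. An induction on shifts needs all entries, since a
    shift involves the neighbouring ones. *)
Definition tw (W : nat -> nat -> F) i j :=
  iter i (shift frame_mx 0) (iter j (shift frame_mx 1) W).

Lemma tw_shift1 W i j k l : shift frame_mx 1 (tw W i j) k l = tw W i j.+1 k l.
Proof. by rewrite /tw -iter_shiftC. Qed.

Lemma vf_shift c a W k l : vf (frame c) (shift frame_mx a W k l) =
  shift frame_mx a (fun k l => vf (frame c) (W k l)) k l +
  (conn c a 0 * shift frame_mx 0 W k l + conn c a 1 * shift frame_mx 1 W k l).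
Proof.
rewrite !shiftE; have h := vf_der (frame c).
rewrite (derD h) !(derM h) !connE; ring.
Qed.

(** Leibniz rule for a symmetric tensor with i slots filled by e_1 and j slots by e_2: every slot
    contributes the derivative of its frame vector, expanded by [conn]. Where i or j is 0, the
    truncated predecessor comes with the factor 0. *)
Lemma vf_tw c W i j k l : vf (frame c) (tw W i j k l) =
  tw (fun k l => vf (frame c) (W k l)) i j k l +
  i%:R * (conn c 0 0 * tw W i j k l + conn c 0 1 * tw W i.-1 j.+1 k l) +
  j%:R * (conn c 1 0 * tw W i.+1 j.-1 k l + conn c 1 1 * tw W i j k l).
Proof.
elim: i k l => [|i IHi] k l.
  elim: j k l => [|j IHj] k l; first by rewrite /tw /=; ring.
  have e V : tw V 0 j.+1 k l = shift frame_mx 1 (tw V 0 j) k l by [].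
  rewrite 2!e vf_shift (shift_ext _ _ IHj).
  have -> : tw W 1 j.+1.-1 k l = shift frame_mx 0 (tw W 0 j) k l by [].
  case: j {IHj e} => [|j]; first by rewrite !shiftE /=; ring.
  have -> : shift frame_mx 0 (tw W 0 j.+1) k l =
     shift frame_mx 1 (tw W 1 j) k l by exact: shiftC.
  by rewrite !shiftE -!natr1 /=; ring.
have e V j' : tw V i.+1 j' k l = shift frame_mx 0 (tw V i j') k l by [].
rewrite 2!e vf_shift (shift_ext _ _ IHi) tw_shift1.
have -> : tw W i.+2 j.-1 k l = shift frame_mx 0 (tw W i.+1 j.-1) k l by [].
have -> : i.+1.-1 = i by [].
case: i {IHi e} => [|i]; first by rewrite !shiftE /=; ring.
have -> : tw W i.+1 j.+1 k l = shift frame_mx 0 (tw W i j.+1) k l by [].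
by rewrite !shiftE -!natr1 /=; ring.
Qed.

Section Generation.
Context (K : F -> Prop) (KP : field_closed K).
Hypotheses (KU : K (U 0 0)) (K3a : K inv3a) (K3b : K inv3b).
Hypothesis Kvf : forall c f, K f -> K (vf (frame c) f).

Lemma conn_generated c a d : K (conn c a d).
Proof.
have Kr b : K (der_ratio b).
  apply: (fc_div KP); last exact: (fc_nat KP).
  apply: (fcD KP); first by apply: (fc_div KP) => //; apply: Kvf.
  by case: ifP => // _; apply: (fc1 KP).
have Ks : K s by apply: (Kvf 0).
have K1 : K (vf frame1 s) by apply: (Kvf 0).
have K2 : K (vf frame2 s) by apply: (Kvf 1).
have K1' := fc1 KP; have K0' := fc0 KP.
rewrite /conn -/s; do !case: ifP => _ //; do ?[by apply: (fcN KP) => //; apply: (fcV KP)];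
  do ![exact: Kr|exact: (fc_nat KP)|assumption|apply: (fcB KP)|apply: (fcN KP)|apply: (fc_div KP)|apply: (fcM KP)].
Qed.

(* Differentiating the component of order [n] along the frame gives the components
   of order [n + 1], up to connection terms of order [n]. *)
Lemma twist_generated i j : K (twist frame_mx U i j).
Proof.
have [n] := ubnP (i + j)%N; elim: n i j => // n IHn i j ijn.
have step c i' j' : (i' + j' < n)%N ->
    K (tw (fun k l => vf (frame c) (U k l)) i' j' 0%N 0%N).
  move=> h; have := Kvf c (IHn _ _ h); rewrite -/(tw U i' j' 0%N 0%N) vf_tw.
  set X := tw _ _ _ _ _; set Y := (X in _ + X + _); set Z := (X in _ + _ + X) => KX.
  have -> : X = X + Y + Z - Z - Y by ring.
  apply: (fcB KP); [apply: (fcB KP) => //|]; clear KX; rewrite /Y /Z {X Y Z}.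
    case: j' h => [|j'] h; first by rewrite mul0r; apply: (fc0 KP).
    apply: (fcM KP); first exact: (fc_nat KP).
    apply: (fcD KP); apply: (fcM KP); try exact: conn_generated.
      by apply: (IHn i'.+1 j'); rewrite addSn -addnS.
    exact: (IHn i' j'.+1).
  case: i' h => [|i'] h; first by rewrite mul0r; apply: (fc0 KP).
  apply: (fcM KP); first exact: (fc_nat KP).
  apply: (fcD KP); apply: (fcM KP); try exact: conn_generated.
    exact: (IHn i'.+1 j').
  by apply: (IHn i' j'.+1); rewrite addnS -addSn.
have e (c : 'I_2) : shift frame_mx c U =2 fun k l => vf (frame c) (U k l).
  move=> k l; rewrite /shift /vf !mxE D0U D1U /=; ring.
case: i ijn => [|i] ijn.
  case: j ijn => [//|j] ijn; rewrite twistSr (twist_ext _ (e _)).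
  exact: (step 1 0%N j).
by rewrite twistSl (twist_ext _ (e _)); apply: (step 0 i j).
Qed.
End Generation.
End Frame.

(** * Behaviour of the frame and the generators under affine transformations *)

Section Equivariance.
Context (F : fieldType) (D0 D1 : F -> F) (D0P : is_der D0) (D1P : is_der D1).
Context (U : nat -> nat -> F).
Hypotheses (D0U : forall i j, D0 (U i j) = U i.+1 j).
Hypotheses (D1U : forall i j, D1 (U i j) = U i j.+1).
Hypotheses (hess0 : hess U != 0).
Hypotheses (dhess0 : vf D0 D1 (vf2 U) (hess U) != 0).
Context (P : {rmorphism F -> F}) (g : 'M[F]_2).
Hypotheses (g0 : \det g != 0) (D0g : forall i j, D0 (g i j) = 0).
Hypothesis D1g : forall i j, D1 (g i j) = 0.
Hypothesis PD0 : forall f, P (D0 f) = g 0 0 * D0 (P f) + g 1 0 * D1 (P f).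
Hypothesis PD1 : forall f, P (D1 f) = g 0 1 * D0 (P f) + g 1 1 * D1 (P f).
Hypothesis PU : P (U 0%N 0%N) = U 0%N 0%N.

Local Notation vfD := (vf D0 D1).

(* [g] is the inverse of the linear part of the transformation [P]. *)
Definition relative (w : F * F) (c : F) : Prop :=
  g 0 0 * P w.1 + g 0 1 * P w.2 = c * w.1 /\
  g 1 0 * P w.1 + g 1 1 * P w.2 = c * w.2.

Lemma relative_vf w c f : relative w c -> P (vfD w f) = c * vfD w (P f).
Proof.
move=> [e1 e2]; rewrite /vf rmorphD !rmorphM /= PD0 PD1.
transitivity (c * w.1 * D0 (P f) + c * w.2 * D1 (P f)); last ring.
rewrite -e1 -e2; ring.
Qed.

Lemma relativeZ w c a b : relative w c -> P a * c = b * a -> relative (a * w.1, a * w.2) b.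
Proof.
move=> [e1 e2] e; split; rewrite /= !rmorphM /= [RHS]mulrA -e -mulrA.
  by rewrite -e1; ring.
by rewrite -e2; ring.
Qed.

Lemma P_u10 : P (U 1 0) = g 0 0 * U 1 0 + g 1 0 * U 0 1.
Proof. by rewrite -D0U PD0 PU D0U D1U. Qed.

Lemma P_u01 : P (U 0 1) = g 0 1 * U 1 0 + g 1 1 * U 0 1.
Proof. by rewrite -D1U PD1 PU D0U D1U. Qed.

Let DE := ((derD D0P), (derD D1P), (derM D0P), (derM D1P), D0g, D1g, D0U, D1U, mul0r, add0r).

Lemma P_u20 : P (U 2 0) =
  g 0 0 ^+ 2 * U 2 0 + g 0 0 * g 1 0 * U 1 1 *+ 2 + g 1 0 ^+ 2 * U 0 2.
Proof. by rewrite -D0U PD0 P_u10 !DE; ring. Qed.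

Lemma P_u11 : P (U 1 1) = g 0 0 * g 0 1 * U 2 0 +
  (g 0 0 * g 1 1 + g 0 1 * g 1 0) * U 1 1 + g 1 0 * g 1 1 * U 0 2.
Proof. by rewrite -D0U PD0 P_u01 !DE; ring. Qed.

Lemma P_u02 : P (U 0 2) =
  g 0 1 ^+ 2 * U 2 0 + g 0 1 * g 1 1 * U 1 1 *+ 2 + g 1 1 ^+ 2 * U 0 2.
Proof. by rewrite -D1U PD1 P_u01 !DE; ring. Qed.

Lemma P_hess : P (hess U) = \det g ^+ 2 * hess U.
Proof.
rewrite /hess rmorphB rmorphXn rmorphM /= P_u20 P_u11 P_u02 det_mx2; ring.
Qed.

Lemma relative_vf1 : relative (vf1 U) (\det g ^+ 2).
Proof.
by split; rewrite /= ?rmorphN !rmorphB !rmorphM /= P_u10 P_u01 P_u20 P_u11 P_u02 det_mx2; ring.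
Qed.

Lemma relative_vf2 : relative (vf2 U) (\det g).
Proof. by split; rewrite /= rmorphN /= P_u10 P_u01 det_mx2; ring. Qed.

Lemma vf_detX w n f : vfD w (\det g ^+ n * f) = \det g ^+ n * vfD w f.
Proof.
have dg : vfD w (\det g) = 0.
  rewrite det_mx2 /vf !((derB D0P), (derB D1P), DE); ring.
have h := vf_der D0P D1P w.
suff e : vfD w (\det g ^+ n) = 0 by rewrite (derM h) e mul0r add0r.
elim: n => [|n IHn]; first exact: (der1 h).
by rewrite exprS (derM h) IHn dg mul0r mulr0 addr0.
Qed.

Lemma P_vf1_hess : P (vfD (vf1 U) (hess U)) = \det g ^+ 4 * vfD (vf1 U) (hess U).
Proof. rewrite (relative_vf _ relative_vf1) P_hess vf_detX; ring. Qed.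

Lemma P_vf2_hess : P (vfD (vf2 U) (hess U)) = \det g ^+ 3 * vfD (vf2 U) (hess U).
Proof. rewrite (relative_vf _ relative_vf2) P_hess vf_detX; ring. Qed.

(** Numerator and denominator both have weight 4 in [\det g]; for [inv3b] below both have weight
    6. *)
Lemma P_inv3a : P (inv3a D0 D1 U) = inv3a D0 D1 U.
Proof.
rewrite /inv3a fmorph_div rmorphXn /= P_vf1_hess P_hess.
by field; rewrite hess0 g0.
Qed.

Lemma P_inv3b : P (inv3b D0 D1 U) = inv3b D0 D1 U.
Proof.
rewrite /inv3b fmorph_div !rmorphXn /= P_vf2_hess P_hess.
by field; rewrite hess0 g0.
Qed.

(** The weights in [\det g] cancel: 2 for [vf1] against 2 for the Hessian determinant, and 1 + 2
    against 3 for the second vector. *)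
Lemma P_frame c f : P (vfD (frame D0 D1 U c) f) = vfD (frame D0 D1 U c) (P f).
Proof.
rewrite -[RHS]mul1r; apply: relative_vf; rewrite /frame; case: ifP => _.
  apply: (relativeZ relative_vf1); rewrite fmorph_div rmorph1 /= P_hess.
  by field; rewrite hess0 g0.
apply: (relativeZ relative_vf2); rewrite fmorph_div /= P_hess P_vf2_hess.
move: hess0 dhess0 g0; move: (vf _ _) (\det g) => x y h0 h1 h2.
by field; rewrite h1 h2.
Qed.
End Equivariance.

(** * Extension of morphisms and derivations to fraction fields *)

Section Quotients.
Context (A : comNzRingType) (F : fieldType) (t : {rmorphism A -> F}).

Lemma quot_eq x y z w : t y != 0 -> t w != 0 ->
  (t x / t y == t z / t w) = (t (x * w) == t (z * y)).
Proof. by move=> y0 w0; rewrite eqr_div // !rmorphM. Qed.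

Lemma quotB x y z w : t y != 0 -> t w != 0 ->
  t x / t y - t z / t w = t (x * w - z * y) / t (y * w).
Proof. by move=> y0 w0; rewrite rmorphB !rmorphM; field; rewrite y0 w0. Qed.

Lemma quotM x y z w : t x / t y * (t z / t w) = t (x * z) / t (y * w).
Proof. by rewrite mulf_div !rmorphM. Qed.

Lemma quot1 x : t x / t 1 = t x.
Proof. by rewrite rmorph1 divr1. Qed.

Lemma quotMr x y z : t z != 0 -> t (x * z) / t (y * z) = t x / t y.
Proof. by move=> z0; rewrite !rmorphM -mulf_div divff ?mulr1. Qed.

Lemma quot_der_sub a b c da db dc : t c != 0 ->
  t ((da - db) * c - (a - b) * dc) / t (c ^+ 2) =
  t (da * c - a * dc) / t (c ^+ 2) - t (db * c - b * dc) / t (c ^+ 2).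
Proof. by move=> c0; rewrite -mulrBl -rmorphB; congr (t _ / _); ring. Qed.

Lemma quot_der_mul a b c da db dc : t c != 0 ->
  t ((da * b + a * db) * (c * c) - a * b * (dc * c + c * dc)) / t ((c * c) ^+ 2) =
  t (da * c - a * dc) / t (c ^+ 2) * (t b / t c) +
  t a / t c * (t (db * c - b * dc) / t (c ^+ 2)).
Proof.
move=> c0; rewrite !(rmorphB, rmorphD, rmorphM, rmorphXn).
by field.
Qed.
End Quotients.

Section FracExtension.
Context (A : idomainType).
Implicit Types (f : {fraction A}).
Local Notation tofrac := (@FracField.tofrac A).

(** [pullbackF] and [total_derF] are defined through the chosen representative [repr f]. This and
    [frac_eq] give access to it, hence to independence of the choice. *)
Lemma fracE f : f = tofrac \n_(repr f) / tofrac \d_(repr f).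
Proof.
have d0 : tofrac \d_(repr f) != 0 by rewrite tofrac_eq0 denom_ratioP.
apply: (canRL (mulfK d0)); set x := repr f.
change (FracField.mul f (tofrac \d_x) = tofrac \n_x).
rewrite -[f]reprK -/x !piE; apply/eqmodP; rewrite /= FracField.equivfE.
by rewrite !numden_Ratio ?(oner_eq0, mulf_neq0, denom_ratioP) // !mulr1 mulrC.
Qed.

Lemma frac_eq (p q p' q' : A) : q != 0 -> q' != 0 ->
  (tofrac p / tofrac q = tofrac p' / tofrac q') <-> (p * q' = p' * q).
Proof.
rewrite -(tofrac_eq0 q) -(tofrac_eq0 q') => q0 q'0.
have h := quot_eq (t := tofrac) p p' q0 q'0; rewrite tofrac_eq in h.
by split=> /eqP e; apply/eqP; [rewrite -h|rewrite h].
Qed.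

Lemma frac_repr (p q : A) : q != 0 ->
  let f := tofrac p / tofrac q in \n_(repr f) * q = p * \d_(repr f).
Proof.
by move=> q0 f; apply/frac_eq => //; rewrite ?denom_ratioP // -fracE.
Qed.
End FracExtension.

Section FracMorphism.
Context (A B : idomainType) (phi : {rmorphism A -> B}) (phi_inj : injective phi).
Local Notation toA := (@FracField.tofrac A).
Local Notation toB := (@FracField.tofrac B).

(** Of the same form as [pullbackF], so that [pullbackFE] holds by conversion. Injectivity of [phi]
    keeps the denominators nonzero. *)
Definition frac_map (f : {fraction A}) : {fraction B} :=
  toB (phi \n_(repr f)) / toB (phi \d_(repr f)).

Lemma phi_neq0 x : x != 0 -> phi x != 0.
Proof. by rewrite (raddf_eq0 _ phi_inj). Qed.

Lemma frac_mapE p q : q != 0 ->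
  frac_map (toA p / toA q) = toB (phi p) / toB (phi q).
Proof.
move=> q0; apply/frac_eq; rewrite ?phi_neq0 ?denom_ratioP //.
by rewrite -!rmorphM (frac_repr p q0).
Qed.

Lemma frac_map_tofrac p : frac_map (toA p) = toB (phi p).
Proof.
by rewrite -[toA p](quot1 toA) frac_mapE ?oner_neq0 // rmorph1 (quot1 toB).
Qed.

Lemma frac_map_is_zmod_morphism : zmod_morphism frac_map.
Proof.
move=> f g; rewrite (fracE f) (fracE g).
move: (denom_ratioP (repr f)) (denom_ratioP (repr g)).
move: \n_(repr f) \d_(repr f) \n_(repr g) \d_(repr g) => a b c d b0 d0.
rewrite (quotB (t := toA)) ?tofrac_eq0 //.
rewrite !frac_mapE ?mulf_neq0 // (quotB (t := toB)) ?tofrac_eq0 ?phi_neq0 //.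
by rewrite rmorphB !rmorphM.
Qed.

Lemma frac_map_is_monoid_morphism : monoid_morphism frac_map.
Proof.
split; first by rewrite -tofrac1 frac_map_tofrac rmorph1 tofrac1.
move=> f g; rewrite (fracE f) (fracE g).
move: (denom_ratioP (repr f)) (denom_ratioP (repr g)).
move: \n_(repr f) \d_(repr f) \n_(repr g) \d_(repr g) => a b c d b0 d0.
rewrite (quotM toA) !frac_mapE ?mulf_neq0 // (quotM toB).
by rewrite !rmorphM.
Qed.

HB.instance Definition _ := GRing.isZmodMorphism.Build _ _ frac_map
  frac_map_is_zmod_morphism.
HB.instance Definition _ := GRing.isMonoidMorphism.Build _ _ frac_map
  frac_map_is_monoid_morphism.

Definition frac_morphism : {rmorphism {fraction A} -> {fraction B}} := frac_map.
End FracMorphism.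

Section FracDerivation.
Context (A : idomainType) (d : A -> A).
Hypothesis dB : forall x y, d (x - y) = d x - d y.
Hypothesis dM : forall x y, d (x * y) = d x * y + x * d y.
Local Notation tofrac := (@FracField.tofrac A).

(** Of the same form as [total_derF], to which it specializes by conversion. *)
Definition frac_der (f : {fraction A}) : {fraction A} :=
  let n := \n_(repr f) in let m := \d_(repr f) in
  tofrac (d n * m - n * d m) / tofrac (m ^+ 2).

(** If n / m is the chosen representative, then n q = p m; differentiating this relation identifies
    the two quotient rules. *)
Lemma frac_derE p q : q != 0 ->
  frac_der (tofrac p / tofrac q) = tofrac (d p * q - p * d q) / tofrac (q ^+ 2).
Proof.
move=> q0; set f := _ / _; rewrite /frac_der.
have := frac_repr p q0; rewrite -/f /=.
have := denom_ratioP (repr f); move: \n_(repr f) \d_(repr f) => n m m0 e.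
have := congr1 d e; rewrite !dM => de.
apply/frac_eq; rewrite ?expf_neq0 //.
have -> : (d n * m - n * d m) * q ^+ 2 =
  (d n * q) * (m * q) - n * q * q * d m by ring.
have -> : d n * q = d p * m + p * d m - n * d q by rewrite -de; ring.
rewrite e.
have -> : (d p * m + p * d m - n * d q) * (m * q) =
  (d p * m + p * d m) * (m * q) - (n * q) * m * d q by ring.
rewrite e; ring.
Qed.

Lemma frac_der_tofrac p : frac_der (tofrac p) = tofrac (d p).
Proof.
have d1 : d 1 = 0.
  by apply: (addIr (d 1)); rewrite add0r -[in RHS](mulr1 1) dM mulr1 mul1r.
rewrite -[tofrac p](quot1 tofrac) frac_derE ?oner_neq0 // d1.
by rewrite mulr1 mulr0 subr0 expr1n (quot1 tofrac).
Qed.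

Lemma frac_der_is_der : is_der frac_der.
Proof.
have dP (f g : {fraction A}) : exists a b c : A,
    c != 0 /\ f = tofrac a / tofrac c /\ g = tofrac b / tofrac c.
  have f0 := denom_ratioP (repr f); have g0 := denom_ratioP (repr g).
  exists (\n_(repr f) * \d_(repr g)), (\n_(repr g) * \d_(repr f)), (\d_(repr f) * \d_(repr g)).
  split; first exact: mulf_neq0.
  split; first by rewrite (quotMr (t := tofrac)) ?tofrac_eq0 // -fracE.
  by rewrite [X in _ / tofrac X]mulrC (quotMr (t := tofrac)) ?tofrac_eq0 // -fracE.
split=> f g; have [a [b [c [c0 [-> ->]]]]] := dP f g.
  rewrite -mulrBl -(rmorphB tofrac) !frac_derE // dB.
  by rewrite (quot_der_sub (t := tofrac)) ?tofrac_eq0.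
rewrite (quotM tofrac) !frac_derE ?mulf_neq0 // !dM.
by rewrite (quot_der_mul (t := tofrac)) ?tofrac_eq0.
Qed.
End FracDerivation.

(** * Polynomials in countably many variables *)

Lemma scale_leibniz (R : comNzRingType) (A : comAlgType R) c c' (x y z t cz cy : A) :
  cy = c' *: y -> cz = c *: z ->
  (c * c') *: (x * y + z * t) = c *: x * cy + cz * (c' *: t).
Proof. by move=> -> ->; rewrite -!scalerAl -!scalerAr !scalerA scalerDr. Qed.

Section Leibniz.
Context (V : nzRingType) (d : V -> V).
Implicit Types (x y z : V).

Lemma leibniz0l (d0 : d 0 = 0) y : d (0 * y) = d 0 * y + 0 * d y.
Proof. by rewrite !mul0r d0 mul0r addr0. Qed.

Lemma leibniz0r (d0 : d 0 = 0) x : d (x * 0) = d x * 0 + x * d 0.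
Proof. by rewrite !mulr0 d0 mulr0 addr0. Qed.

Lemma leibniz_subst x y xy dx dy dxy : xy = x * y ->
  d xy = dxy -> d x = dx -> d y = dy -> dxy = dx * y + x * dy ->
  d (x * y) = d x * y + x * d y.
Proof. by move=> <- -> -> ->. Qed.

Hypothesis dD : forall x y, d (x + y) = d x + d y.

Lemma leibniz_addl x y z : d (x * z) = d x * z + x * d z ->
  d (y * z) = d y * z + y * d z ->
  d ((x + y) * z) = d (x + y) * z + (x + y) * d z.
Proof. by move=> e e'; rewrite mulrDl !dD e e' !mulrDl addrACA. Qed.

Lemma leibniz_addr x y z : d (x * y) = d x * y + x * d y ->
  d (x * z) = d x * z + x * d z ->
  d (x * (y + z)) = d x * (y + z) + x * d (y + z).
Proof. by move=> e e'; rewrite mulrDr !dD e e' !mulrDr addrACA. Qed.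
End Leibniz.

Lemma scale_mulAC (R : nzRingType) (A : comAlgType R) c (x y z : A) :
  c *: (x * y * z) = c *: (x * z) * y.
Proof. by rewrite -scalerAl mulrAC. Qed.

Lemma scale_mulA (R : nzRingType) (A : comAlgType R) c (x y z : A) :
  c *: (x * y * z) = x * (c *: (y * z)).
Proof. by rewrite -scalerAr mulrA. Qed.

Lemma scale_nat0l (R : nzRingType) (A : lalgType R) (x y z : A) :
  0%:R *: x = 0%:R *: y * z.
Proof. by rewrite !scale0r mul0r. Qed.

Lemma scale_nat0r (R : nzRingType) (A : lalgType R) (x y z : A) :
  0%:R *: x = z * (0%:R *: y).
Proof. by rewrite !scale0r mulr0. Qed.

Lemma eq_big_muladd (V : nzRingType) (J : Type) (r : seq J) (f g h : J -> V) a b :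
  (forall i, f i = g i * b + a * h i) ->
  \sum_(i <- r) f i = (\sum_(i <- r) g i) * b + a * \sum_(i <- r) h i.
Proof.
move=> e; rewrite mulr_suml mulr_sumr -big_split.
by apply: eq_bigr => i _; rewrite e.
Qed.

Section MalgInduction.
Context (I : choiceType) (R : comNzRingType).
Implicit Types (m : {cmonom I}) (p q : {malg R[{cmonom I}]}).

Lemma ucm_divcm m i : m i != 0%N -> (ucm i * divcm m (ucm i))%M = m.
Proof.
move=> mi; apply/eqP/cmP => j; rewrite cmM divcmE ucmE.
by case: eqP => [<-|_]; rewrite ?add0n ?subn0 // subnKC // lt0n.
Qed.

Lemma malgUM (c c' : R) m m' :
  << c *g m >> * << c' *g m' >> = << c * c' *g (m * m')%M >>.
Proof. exact: fgmulUU. Qed.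

Lemma malgU1M m m' : << m >> * << m' >> = << (m * m')%M >> :> {malg R[{cmonom I}]}.
Proof. by rewrite malgUM mulr1. Qed.

Lemma malgUZ c m : << c *g m >> = c *: << m >> :> {malg R[{cmonom I}]}.
Proof. by rewrite -[RHS]mul_malgC malgUM mulr1 mul1m. Qed.

Lemma malg_add_ind (P : {malg R[{cmonom I}]} -> Prop) :
    P 0 -> (forall p q, P p -> P q -> P (p + q)) ->
    (forall c m, P << c *g m >>) -> forall p, P p.
Proof. by move=> P0 PD PU p; rewrite (monalgE p); apply: big_ind. Qed.

(** Additivity reduces to a single term, which is handled by induction on its degree, splitting off
    one variable that divides it. *)
Lemma malg_ring_ind (P : {malg R[{cmonom I}]} -> Prop) :
    (forall c, P c%:MP) -> (forall i, P << ucm i >>) ->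
    (forall p q, P p -> P q -> P (p + q)) ->
    (forall p q, P p -> P q -> P (p * q)) -> forall p, P p.
Proof.
move=> PC PX PD PM; apply: malg_add_ind => // [|c m].
  by have := PC 0; rewrite malgC0E.
have [n] := ubnP (mdeg m); elim: n m c => // n IHn m c mn.
have [e|[i im]] := fset_0Vmem (finsupp m).
  suff -> : m = 1%M by apply: PC.
  by apply/eqP/cmP => i; rewrite cm1; apply/fsfun_dflt; rewrite e.
have mi : m i != 0%N by rewrite cmE_neq0.
rewrite -(ucm_divcm mi) -[c]mul1r -malgUM; apply: PM => //; apply: IHn.
by move: mn; rewrite -{1}(ucm_divcm mi) mdegM mdegU add1n ltnS.
Qed.
End MalgInduction.

Section PolyDer.
Context (I : choiceType) (R : comNzRingType) (v : I -> {malg R[{cmonom I}]}).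
Implicit Types (m : {cmonom I}) (p q : {malg R[{cmonom I}]}).

Definition monom_der m : {malg R[{cmonom I}]} :=
  \sum_(i <- finsupp m) (m i)%:R *: (<< divcm m (ucm i) >> * v i).

(** Exhibits [poly_der] as a linear extension from monomials, so that additivity is inherited from
    [mmap]. *)
Lemma poly_derE p : poly_der v p = mmap (@malgC {cmonom I} R) monom_der p.
Proof.
apply: eq_bigr => m _; rewrite [RHS]mul_malgC /monom_der scaler_sumr.
by apply: eq_bigr => i _; rewrite scalerA mulr_natr.
Qed.

Lemma poly_derB p q : poly_der v (p - q) = poly_der v p - poly_der v q.
Proof. by rewrite !poly_derE raddfB. Qed.

Lemma poly_derD p q : poly_der v (p + q) = poly_der v p + poly_der v q.
Proof. by rewrite !poly_derE raddfD. Qed.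

Lemma poly_der0 : poly_der v 0 = 0.
Proof. by rewrite poly_derE raddf0. Qed.

Lemma poly_derU c m : poly_der v << c *g m >> = c *: monom_der m.
Proof. by rewrite poly_derE mmapU mul_malgC. Qed.

Lemma monom_derEw (d : {fset I}) m : (finsupp m `<=` d)%fset ->
  monom_der m = \sum_(i <- d) (m i)%:R *: (<< divcm m (ucm i) >> * v i).
Proof.
move=> le; rewrite /monom_der (big_fset_incl _ le) // => i _.
by move=> /fsfun_dflt ->; rewrite scale0r.
Qed.

Lemma divcmMl m m' i : m i != 0%N ->
  divcm (m * m')%M (ucm i) = (divcm m (ucm i) * m')%M.
Proof.
move=> mi; apply/eqP/cmP => j; rewrite cmM !divcmE cmM ucmE.
case: eqP => [<-|_]; last by rewrite !subn0.
by rewrite addnC -addnBA ?lt0n // addnC.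
Qed.

(** Compared variable by variable, with exponents adding up. Where an exponent is 0 the quotient
    monomial is truncated and [divcmMl] does not apply, but the coefficient is 0. *)
Lemma monom_derM m m' : monom_der (m * m')%M =
  monom_der m * << m' >> + << m >> * monom_der m'.
Proof.
rewrite (@monom_derEw (finsupp m `|` finsupp m')%fset) ?mdomD ?fsubset_refl //.
rewrite (@monom_derEw (finsupp m `|` finsupp m')%fset m) ?fsubsetUl //.
rewrite (@monom_derEw (finsupp m `|` finsupp m')%fset m') ?fsubsetUr //.
apply: eq_big_muladd => i.
rewrite cmM natrD scalerDl; congr (_ + _).
  have [->|mi] := eqVneq (m i) 0%N.
    exact: scale_nat0l.
  rewrite divcmMl // -malgU1M; move: << _ >> << _ >> (v i) => x y z.
  exact: scale_mulAC.
have [->|mi] := eqVneq (m' i) 0%N.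
  exact: scale_nat0r.
rewrite mulmC divcmMl // mulmC -malgU1M; move: << _ >> << _ >> (v i) => x y z.
exact: scale_mulA.
Qed.

Lemma poly_derM p q : poly_der v (p * q) = poly_der v p * q + p * poly_der v q.
Proof.
elim/malg_add_ind: p => [|p p' IH IH'|c m].
- exact: (leibniz0l poly_der0).
- exact: (leibniz_addl poly_derD IH IH').
elim/malg_add_ind: q => [|q q' IH IH'|c' m'].
- exact: (leibniz0r poly_der0).
- exact: (leibniz_addr poly_derD IH IH').
apply: (leibniz_subst (esym (malgUM c c' m m')) (poly_derU _ _) (poly_derU _ _)
  (poly_derU _ _)).
apply: etrans (congr1 _ (monom_derM m m')) _.
exact: (scale_leibniz _ _ (malgUZ _ _) (malgUZ _ _)).
Qed.

Lemma poly_derC c : poly_der v c%:MP = 0.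
Proof.
by rewrite poly_derU /monom_der mdom1 big_seq_fset0 scaler0.
Qed.

Lemma poly_derX i : poly_der v << ucm i >> = v i.
Proof.
rewrite poly_derU scale1r /monom_der mdomU big_seq_fset1 cmUU scale1r.
suff -> : divcm (ucm i) (ucm i) = 1%M by rewrite mul1r.
by apply/eqP/cmP => j; rewrite divcmE subnn cm1.
Qed.
End PolyDer.

Section Evaluation.
Context (I : choiceType) (R : comNzRingType) (S : comNzRingType).
Context (c : {rmorphism R -> S}) (v : I -> S).

(** [jet_eval], [pullback] and [realize] are instances by conversion, and thereby ring morphisms. *)
Definition peval (p : {malg R[{cmonom I}]}) : S := mmap c (meval v) p.

Lemma peval_is_zmod_morphism : zmod_morphism peval.
Proof. by move=> p q; rewrite /peval raddfB. Qed.

Lemma peval_is_monoid_morphism : monoid_morphism peval.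
Proof. by split=> [|p q]; rewrite /peval ?rmorph1 ?rmorphM. Qed.

HB.instance Definition _ := GRing.isZmodMorphism.Build _ _ peval
  peval_is_zmod_morphism.
HB.instance Definition _ := GRing.isMonoidMorphism.Build _ _ peval
  peval_is_monoid_morphism.

Lemma pevalC a : peval a%:MP = c a.
Proof. exact: mmapC. Qed.

Lemma pevalX i : peval << ucm i >> = v i.
Proof.
rewrite /peval; apply: etrans; first exact: mmapU.
apply: etrans (congr1 (fun z => z * _) (rmorph1 c)) _.
by rewrite mul1r /= /meval mdomU big_seq_fset1 cmUU expr1.
Qed.

Lemma peval_unique (phi : {rmorphism {malg R[{cmonom I}]} -> S}) :
  (forall a, phi a%:MP = c a) -> (forall i, phi << ucm i >> = v i) ->
  forall p, phi p = peval p.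
Proof.
move=> hC hX; elim/malg_ring_ind => [a|i|p q IHp IHq|p q IHp IHq].
- by rewrite pevalC hC.
- by rewrite pevalX hX.
- by rewrite !rmorphD IHp IHq.
- by rewrite !rmorphM IHp IHq.
Qed.
End Evaluation.

Lemma peval_comp (I : choiceType) (R S T : comNzRingType) (c : {rmorphism R -> S})
    (phi : {rmorphism S -> T}) (c' : {rmorphism R -> T}) v p :
  (forall a, phi (c a) = c' a) ->
  phi (peval c v p) = peval (I := I) c' (phi \o v) p.
Proof.
move=> e; apply: (@peval_unique I R T c' _ (phi \o peval c v)) => [a|i] /=.
  by rewrite pevalC.
by rewrite pevalX.
Qed.

Lemma peval_ext (I : choiceType) (R S : comNzRingType) (c : {rmorphism R -> S}) v v' :
  v =1 v' -> peval (I := I) c v =1 peval c v'.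
Proof.
move=> e p; apply: peval_unique => [a|i]; first exact: pevalC.
by rewrite /= pevalX e.
Qed.

(** Serves to prove that a morphism [phi] intertwines two derivations: both composites are
    derivations along [phi], so that constants and variables suffice. *)
Lemma malg_der_ext (I : choiceType) (R S : comNzRingType)
    (phi : {rmorphism {malg R[{cmonom I}]} -> S}) (d d' : {malg R[{cmonom I}]} -> S) :
    (forall a, d a%:MP = d' a%:MP) -> (forall i, d << ucm i >> = d' << ucm i >>) ->
    (forall p q, d (p + q) = d p + d q) -> (forall p q, d' (p + q) = d' p + d' q) ->
    (forall p q, d (p * q) = d p * phi q + phi p * d q) ->
    (forall p q, d' (p * q) = d' p * phi q + phi p * d' q) ->
  d =1 d'.
Proof.
move=> hC hX dD d'D dM d'M; elim/malg_ring_ind => // p q IHp IHq.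
  by rewrite dD d'D IHp IHq.
by rewrite dM d'M IHp IHq.
Qed.

(** In characteristic zero the integers from 0 to [size p] - 1 are distinct, too many to be all
    roots. *)
Lemma exists_nonroot (R : idomainType) (p : {poly R}) :
  (forall n, n.+1%:R != 0 :> R) -> p != 0 -> exists n : nat, p.[n%:R] != 0.
Proof.
move=> char0 p0.
have inj : injective (fun n : nat => n%:R : R).
  have le (m n : nat) : (m <= n)%N -> m%:R = n%:R :> R -> m = n.
    move=> /subnK <- /eqP; rewrite natrD eq_sym -subr_eq0 addrK.
    by case: (n - m)%N => // k e0; have := char0 k; rewrite e0.
  move=> m n e; case/orP: (leq_total m n) => h; first exact: le.
  by apply/esym/le.
have [/hasP[x /mapP[n _ ->]]|] := boolP (has (fun x => ~~ root p x)
    [seq n%:R | n <- iota 0 (size p)]); first by exists n.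
rewrite -all_predC => h; exfalso.
suff : (size p < size p)%N by rewrite ltnn.
rewrite -{1}(size_iota 0 (size p)) -(size_map (fun n => n%:R : R)).
apply: max_poly_roots p0 _ _.
  by apply: sub_all h => x /=; rewrite negbK.
by rewrite map_inj_uniq ?iota_uniq.
Qed.

(** The Kronecker substitution yields a nonzero univariate polynomial; a natural non-root of it
    gives the values. Natural numbers are chosen because they lie in every subfield. *)
Lemma exists_nonzero_value (I : countType) (R : idomainType)
    (p : {malg R[{cmonom I}]}) :
  (forall n, n.+1%:R != 0 :> R) -> p != 0 ->
  exists v : I -> nat, peval idfun (fun i => (v i)%:R) p != 0.
Proof.
move=> char0 p0; have k0 := kron_neq0 p0 (leqnn _).
have [n hn] := exists_nonroot char0 k0.
exists (fun i => n ^ (expbound p ^ choice.pickle i))%N.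
apply: contraNneq hn => e; apply/eqP; apply: etrans e.
pose ev := horner_eval n%:R : {rmorphism {poly R} -> R}.
have evC a : ev (polyC a) = idfun a by rewrite /ev /= /horner_eval hornerC.
pose X (i : I) : {poly R} := 'X ^+ (expbound p ^ choice.pickle i).
transitivity (ev (peval (@polyC R) X p)); first by [].
rewrite (peval_comp X p evC); apply: peval_ext => i.
by rewrite /= /horner_eval hornerXn natrX.
Qed.

Section ScaledDerivations.
Context (R : comNzRingType) (A : comAlgType R) (D : 'I_2 -> A -> A) (c : 'I_2 -> R).
Hypothesis dD : forall b x y, D b (x + y) = D b x + D b y.
Hypothesis dM : forall b x y, D b (x * y) = D b x * y + x * D b y.

Let N x := \sum_b c b *: D b x.

Lemma scaled_derD x y : N (x + y) = N x + N y.
Proof.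
by rewrite /N -big_split; apply: eq_bigr => b _; rewrite dD scalerDr.
Qed.

Lemma scaled_derM x y : N (x * y) = N x * y + x * N y.
Proof.
rewrite /N mulr_suml mulr_sumr -big_split; apply: eq_bigr => b _.
by rewrite dM scalerDr scalerAl scalerAr.
Qed.
End ScaledDerivations.

(* Constant coefficient combinations of the derivations commute, so that iterating
   them on the jet coordinates is the substitution [twist]. *)
Lemma iter_der_twist (A : comNzRingType) (D0 D1 : A -> A) (N : 'I_2 -> A -> A)
    (G : 'M[A]_2) (U : nat -> nat -> A) :
    (forall x y, D0 (x + y) = D0 x + D0 y) -> (forall x y, D1 (x + y) = D1 x + D1 y) ->
    (forall b a x, D0 (G b a * x) = G b a * D0 x) ->
    (forall b a x, D1 (G b a * x) = G b a * D1 x) ->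
    (forall a x, N a x = G 0 a * D0 x + G 1 a * D1 x) ->
    (forall k l, D0 (U k l) = U k.+1 l) -> (forall k l, D1 (U k l) = U k l.+1) ->
  (forall i j, iter i (N 0) (iter j (N 1) (U 0 0)) = twist G U i j) /\
  (forall i j, N 1 (twist G U i j) = twist G U i j.+1).
Proof.
move=> D0D D1D D0G D1G NE D0U D1U.
pose good (W : nat -> nat -> A) :=
  (forall k l, D0 (W k l) = W k.+1 l) /\ (forall k l, D1 (W k l) = W k l.+1).
have good_shift a W : good W -> good (shift G a W).
  move=> [h0 h1]; split=> k l; rewrite /shift.
    by rewrite D0D !D0G !h0.
  by rewrite D1D !D1G !h1.
have good_iter a n W : good W -> good (iter n (shift G a) W).
  by move=> h; elim: n => //= n; apply: good_shift.
have Nit a n W k l : good W -> iter n (N a) (W k l) = iter n (shift G a) W k l.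
  move=> h; elim: n => //= n ->; rewrite NE.
  by have [h0 h1] := good_iter a n W h; rewrite h0 h1.
split=> i j; first by rewrite !Nit //; apply: good_iter.
have [|h0 h1] := good_iter 0 i (iter j (shift G 1) U); first exact: good_iter.
by rewrite /twist NE h0 h1 /= iter_shiftC.
Qed.

Lemma der_affine (R : comNzRingType) (A : comAlgType R) (C : R -> A) (d : A -> A)
    (a : 'I_2) (x : 'I_2 -> A) (k : A) (r : 'I_2 -> R) :
    (forall x y, d (x + y) = d x + d y) -> (forall c x, d (c *: x) = C c * d x) ->
    (forall b, d (x b) = (a == b)%:R) -> d k = 0 ->
  d (\sum_b r b *: x b + k) = C (r a).
Proof.
move=> dD dZ dx dk; rewrite dD dk addr0 sum_I2 dD !dZ !dx.
by move: a {dx}; apply: I2_cases; rewrite mulr1 mulr0 ?addr0 ?add0r.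
Qed.

Lemma map_mx_comb (R A : comNzRingType) (C : {rmorphism R -> A}) (g : 'M[R]_2) a r s x y :
  x = C r -> y = C s ->
  map_mx C g 0 a * x + map_mx C g 1 a * y = C (r * g 0 a + s * g 1 a).
Proof.
by move=> -> ->; rewrite !mxE rmorphD !rmorphM; congr (_ + _); apply: mulrC.
Qed.

(** * Prolonged action on rational functions *)

Section JetAlgebra.
Context (R : realType).
Local Notation A := (jetpoly R).
Local Notation F := (jetrat R).
Local Notation C := (@malgC {cmonom Defs.coord} R).
Local Notation toF := (@FracField.tofrac A).
Implicit Types (p q : A) (f : F) (h : acsp R).

Lemma total_derD a p q : total_der a (p + q) = total_der a p + total_der a q.
Proof. exact: poly_derD. Qed.
Lemma total_derB a p q : total_der a (p - q) = total_der a p - total_der a q.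
Proof. exact: poly_derB. Qed.
Lemma total_derM a p q : total_der a (p * q) = total_der a p * q + p * total_der a q.
Proof. exact: poly_derM. Qed.
Lemma total_derC a c : total_der a (C c) = 0.
Proof. exact: poly_derC. Qed.
Lemma total_der_base a b : total_der a (var R (inl b)) = (a == b)%:R.
Proof. exact: (poly_derX _ (inl b)). Qed.
Lemma total_der0_u i j : total_der 0 (var R (inr (i, j))) = var R (inr (i.+1, j)).
Proof. exact: (poly_derX _ (inr (i, j))). Qed.
Lemma total_der1_u i j : total_der 1 (var R (inr (i, j))) = var R (inr (i, j.+1)).
Proof. exact: (poly_derX _ (inr (i, j))). Qed.

Lemma total_derCM a c p : total_der a (C c * p) = C c * total_der a p.
Proof. by rewrite (total_derM a (C c) p) (total_derC a c) mul0r add0r. Qed.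

Lemma total_derF_der a : is_der (@total_derF R a).
Proof. exact: (frac_der_is_der (total_derB a) (total_derM a)). Qed.

Lemma total_derF_tofrac a p : total_derF a (toF p) = toF (total_der a p).
Proof. exact: (frac_der_tofrac (total_derM a)). Qed.

Lemma total_derF0_u i j : total_derF 0 (u_ R i j) = u_ R i.+1 j.
Proof. exact: etrans (total_derF_tofrac _ _) (congr1 _ (total_der0_u i j)). Qed.
Lemma total_derF1_u i j : total_derF 1 (u_ R i j) = u_ R i j.+1.
Proof. exact: etrans (total_derF_tofrac _ _) (congr1 _ (total_der1_u i j)). Qed.

Definition lin_inv h : 'M[R]_2 := invmx (lin h).

(** Preservation of [omega] on the two basis vectors says that the symplectic part has determinant
    1. *)
Lemma det_lin h : \det (lin h) = dilation h ^+ 2.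
Proof.
rewrite /lin detZ.
have := sp_partP h (delta_mx 0 0) (delta_mx 1 0).
rewrite /omega -!colE !mxE /= det_mx2 => e.
suff -> : sp_part h 0 0 * sp_part h 1 1 - sp_part h 0 1 * sp_part h 1 0 = 1.
  by rewrite mulr1.
by rewrite [sp_part h 0 1 * _]mulrC e mulr1 mulr0 subr0.
Qed.

Lemma lin_unit h : lin h \in unitmx.
Proof.
by rewrite unitmxE det_lin unitfE expf_neq0 // gt_eqF // dilationP.
Qed.

Lemma det_lin_inv_neq0 h : \det (lin_inv h) != 0.
Proof. by rewrite det_inv invr_eq0 -unitfE -unitmxE lin_unit. Qed.

Lemma new_derD h a p q : new_der h a (p + q) = new_der h a p + new_der h a q.
Proof. exact: (scaled_derD (A := A) _ total_derD). Qed.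

Lemma new_derM h a p q : new_der h a (p * q) = new_der h a p * q + p * new_der h a q.
Proof. exact: (scaled_derM (A := A) _ total_derM). Qed.

Lemma new_derE h a p : new_der h a p =
  map_mx C (lin_inv h) 0 a * total_der 0 p + map_mx C (lin_inv h) 1 a * total_der 1 p.
Proof.
rewrite /new_der sum_I2 !mxE.
by congr (_ + _); apply/esym/mul_malgC.
Qed.

Definition var_u i j : A := var R (inr (i, j)).

Lemma new_uE_new_der h : (forall i j, new_u h i j = twist (map_mx C (lin_inv h)) var_u i j) /\
  (forall i j, new_der h 1 (twist (map_mx C (lin_inv h)) var_u i j) =
     twist (map_mx C (lin_inv h)) var_u i j.+1).
Proof.
apply: (@iter_der_twist A (total_der 0) (total_der 1) (new_der h)).
- exact: total_derD.
- exact: total_derD.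
- by move=> b a x; rewrite mxE; apply: total_derCM.
- by move=> b a x; rewrite mxE; apply: total_derCM.
- exact: new_derE.
- exact: total_der0_u.
- exact: total_der1_u.
Qed.

Lemma new_uE h i j : new_u h i j = twist (map_mx C (lin_inv h)) var_u i j.
Proof. by case: (new_uE_new_der h). Qed.

Lemma new_der1_u h i j : new_der h 1 (new_u h i j) = new_u h i j.+1.
Proof.
rewrite (new_uE h i j) (new_uE h i j.+1).
by case: (new_uE_new_der h) => _; apply.
Qed.
End JetAlgebra.

Section Pullback.
Context (R : realType).
Local Notation A := (jetpoly R).
Local Notation F := (jetrat R).
Local Notation C := (@malgC {cmonom Defs.coord} R).
Local Notation toF := (@FracField.tofrac A).
Implicit Types (p q : A) (f : F) (h : acsp R) (t : jet R).

Definition pullback_var h (c : Defs.coord) : A :=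
  match c with
  | inl a => \sum_b lin h a b *: var R (inl b) + C (translation h a 0)
  | inr (i, j) => new_u h i j
  end.


Lemma pullback_var_u h i j : pullback h (var R (inr (i, j))) = new_u h i j.
Proof. exact: (pevalX C (pullback_var h) (inr (i, j))). Qed.

Lemma pullback_var_base h a : pullback h (var R (inl a)) =
  \sum_b lin h a b *: var R (inl b) + C (translation h a 0).
Proof. exact: (pevalX C (pullback_var h) (inl a)). Qed.

Lemma new_derC h a c : new_der h a (C c) = 0.
Proof.
apply: etrans (new_derE _ _ _) _; rewrite !total_derC.
by rewrite !mulr0 addr0.
Qed.

Lemma total_der_scale a c p : total_der a (c *: p) = C c * total_der a p.
Proof. by rewrite -[c *: p]mul_malgC; apply: total_derCM. Qed.

Lemma total_der_affine d (r : 'I_2 -> R) c :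
  total_der d (\sum_b r b *: var R (inl b) + C c) = C (r d).
Proof.
apply: (der_affine (A := A) (C := C)).
- exact: total_derD.
- exact: total_der_scale.
- exact: total_der_base.
- exact: total_derC.
Qed.

Lemma new_der_affine h a (r : 'I_2 -> R) c :
  new_der h a (\sum_b r b *: var R (inl b) + C c) =
  C (r 0 * lin_inv h 0 a + r 1 * lin_inv h 1 a).
Proof.
apply: etrans (new_derE _ _ _) _.
exact: (map_mx_comb _ _ (total_der_affine 0 r c) (total_der_affine 1 r c)).
Qed.

Lemma new_der_pullback_base h a b :
  new_der h a (pullback h (var R (inl b))) = (a == b)%:R.
Proof.
rewrite pullback_var_base; apply: etrans (new_der_affine _ _ _ _) _.
have -> : lin h b 0 * lin_inv h 0 a + lin h b 1 * lin_inv h 1 a = (a == b)%:R.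
  have := congr1 (fun M : 'M_2 => M b a) (mulmxV (lin_unit h)).
  by rewrite /= [LHS]mxE sum_I2 [X in _ = X -> _]mxE eq_sym; apply.
exact: (rmorph_nat C).
Qed.

(** The chain rule. On the base coordinates it expresses that [lin_inv h] inverts the linear part,
    on the derivatives of u the recursion for [new_u]. *)
Lemma pullback_total_der h a p :
  pullback h (total_der a p) = new_der h a (pullback h p).
Proof.
pose P : {rmorphism A -> A} := peval C (pullback_var h).
apply: (malg_der_ext (phi := P) (d := fun p => pullback h (total_der a p))
  (d' := fun p => new_der h a (pullback h p))).
- move=> c; rewrite (total_derC a c).
  by rewrite [X in new_der h a X](pevalC C (pullback_var h) c) new_derC; apply: (rmorph0 P).
- move=> [b|[i j]].
    rewrite [X in _ = X]new_der_pullback_base.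
    apply: etrans (congr1 _ (total_der_base R a b)) _; exact: (rmorph_nat P).
  rewrite [X in _ = new_der h a X]pullback_var_u; move: a; apply: I2_cases.
    (* For D_X, applied last in [new_u], this is the definition; D_Y has to be commuted past D_X
       first, by [new_der1_u]. *)
    by apply: etrans (congr1 _ (total_der0_u R i j)) _; apply: pullback_var_u.
  rewrite new_der1_u.
  by apply: etrans (congr1 _ (total_der1_u R i j)) _; apply: pullback_var_u.
- move=> p1 p2; rewrite total_derD; exact: (rmorphD P).
- move=> p1 p2; apply: etrans (congr1 _ (rmorphD P p1 p2)) _; exact: new_derD.
- move=> p1 p2; rewrite total_derM; apply: etrans (rmorphD P _ _) _.
  by congr (_ + _); apply: (rmorphM P).
- move=> p1 p2; apply: etrans (congr1 _ (rmorphM P p1 p2)) _; exact: new_derM.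
Qed.

Lemma jet_evalE t p : jet_eval t p = peval idfun (jet_coord t) p.
Proof. by []. Qed.

Lemma jet_eval_var t c : jet_eval t (var R c) = jet_coord t c.
Proof. exact: (pevalX idfun (jet_coord t) c). Qed.

Lemma prolong_u h t i j : (prolong h t).2 i j = twist (lin_inv h) t.2 i j.
Proof.
rewrite /= new_uE.
pose ev : {rmorphism A -> R} := peval idfun (jet_coord t).
apply: etrans (twist_map ev _ _ _ _) _.
have -> : map_mx ev (map_mx C (lin_inv h)) = lin_inv h.
  apply/matrixP => a b; rewrite !mxE; exact: (pevalC idfun (jet_coord t)).
by apply: twist_ext => k l; apply: jet_eval_var.
Qed.

(** The preimage comes from the inverse affine map and the twist by the linear part. Only
    coordinates are compared, since a jet contains a function. *)
Lemma prolong_surj h t : exists t', jet_coord (prolong h t') =1 jet_coord t.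
Proof.
exists (lin_inv h *m (t.1 - translation h), twist (lin h) t.2) => -[a|[i j]].
  by rewrite /= /act /= mulmxA mulmxV ?lin_unit // mul1mx subrK.
rewrite /jet_coord prolong_u twistM mulmxV ?lin_unit //; exact: twist1.
Qed.

Lemma jet_poly_neq0 p : p != 0 -> exists t, jet_eval t p != 0.
Proof.
move=> p0; have [|v hv] := exists_nonzero_value _ p0.
  by move=> n; rewrite pnatr_eq0.
exists (\col_a (v (inl a))%:R, fun i j => (v (inr (i, j)))%:R).
apply: contraNneq hv => e; apply/eqP; apply: etrans e.
by apply: peval_ext => -[a|[i j]]; rewrite //= mxE.
Qed.

(** A nonzero polynomial has a nonzero value at some jet, and every jet is in the image of the
    prolonged action. *)
Lemma pullback_eq0 h p : pullback h p = 0 -> p = 0.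
Proof.
move=> e; apply/eqP; apply: contraT => /jet_poly_neq0[t].
have [t' et] := prolong_surj h t.
rewrite jet_evalE -(peval_ext _ et) -jet_evalE -jet_eval_pullback e.
by rewrite jet_evalE rmorph0 eqxx.
Qed.

Lemma pullback_inj h : injective (peval C (pullback_var h)).
Proof. by apply/raddf_inj => p; apply: pullback_eq0. Qed.

Definition pullbackR h : {rmorphism F -> F} := frac_morphism (@pullback_inj h).
Lemma pullbackFE h f : pullbackF h f = pullbackR h f.
Proof. by []. Qed.
End Pullback.

Lemma map_mx_comb_comp (R A F : comNzRingType) (t : {rmorphism A -> F})
    (C : {rmorphism R -> A}) (g : 'M[R]_2) a x y X Y :
  X = t x -> Y = t y ->
  t (map_mx C g 0 a * x + map_mx C g 1 a * y) =
  map_mx (t \o C) g 0 a * X + map_mx (t \o C) g 1 a * Y.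
Proof. by move=> -> ->; rewrite rmorphD !rmorphM !mxE. Qed.

(** Writing f q = p, the product rule determines the value at f from those at p and q, because P q
    is nonzero. *)
Lemma frac_twisted_der_ext (A : idomainType) (F : fieldType)
    (P : {rmorphism {fraction A} -> F}) (d d' : {fraction A} -> F) :
    (forall x y, d (x * y) = d x * P y + P x * d y) ->
    (forall x y, d' (x * y) = d' x * P y + P x * d' y) ->
    (forall p, d (FracField.tofrac p) = d' (FracField.tofrac p)) ->
  d =1 d'.
Proof.
move=> dM d'M e f; have q0 := denom_ratioP (repr f).
have := fracE f; move: \n_(repr f) \d_(repr f) q0 => p q q0 ef.
have q0' : FracField.tofrac q != 0 :> {fraction A} by rewrite tofrac_eq0.
have efq : f * FracField.tofrac q = FracField.tofrac p by rewrite ef divfK.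
have := e p; rewrite -efq dM d'M e => /addIr; apply: mulIf.
by rewrite fmorph_eq0.
Qed.

Section Invariance.
Context (R : realType).
Local Notation A := (jetpoly R).
Local Notation F := (jetrat R).
Local Notation C := (@malgC {cmonom Defs.coord} R).
Local Notation toF := (@FracField.tofrac A).
Implicit Types (p q : A) (f : F) (h : acsp R) (t : jet R).

Definition constF : {rmorphism R -> F} := toF \o C.

Lemma total_derF_const a c : total_derF a (constF c) = 0.
Proof.
apply: etrans (total_derF_tofrac _ _) _.
by apply: etrans (congr1 toF (total_derC a c)) (rmorph0 toF).
Qed.

Definition lin_invF h : 'M[F]_2 := map_mx constF (lin_inv h).

Lemma pullbackR_tofrac h p : pullbackR h (toF p) = toF (pullback h p).
Proof. exact: (frac_map_tofrac (@pullback_inj R h) p). Qed.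

Lemma pullbackR_const h c : pullbackR h (constF c) = constF c.
Proof.
apply: etrans (pullbackR_tofrac _ _) _.
exact: (congr1 toF (pevalC C (pullback_var h) c)).
Qed.

Lemma pullbackR_u h : pullbackR h (u_ R 0 0) = u_ R 0 0.
Proof.
apply: etrans (pullbackR_tofrac _ _) _.
exact: (congr1 toF (pullback_var_u h 0 0)).
Qed.

Lemma pullbackR_total_der h a f : pullbackR h (total_derF a f) =
  lin_invF h 0 a * total_derF 0 (pullbackR h f) +
  lin_invF h 1 a * total_derF 1 (pullbackR h f).
Proof.
move: f; apply: (frac_twisted_der_ext (P := pullbackR h)).
- move=> x y; rewrite (derM (total_derF_der R a)) rmorphD.
  by congr (_ + _); apply: rmorphM.
- pose N := is_der_lin (lin_invF h 0 a) (lin_invF h 1 a)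
    (total_derF_der R 0) (total_derF_der R 1).
  by move=> x y; rewrite rmorphM; apply: (derM N).
move=> p; rewrite [in LHS]total_derF_tofrac !pullbackR_tofrac pullback_total_der.
apply: etrans (congr1 toF (new_derE h a (pullback h p))) _.
exact: (map_mx_comb_comp (t := toF) C _ _ (total_derF_tofrac _ _) (total_derF_tofrac _ _)).
Qed.

Lemma det_lin_invF h : \det (lin_invF h) != 0.
Proof. by rewrite det_map_mx fmorph_eq0 det_lin_inv_neq0. Qed.
End Invariance.

(** * Nondegeneracy of the frame, checked at one jet *)

Section PolynomialValue.
Context (R : realType) (t : jet R).
Local Notation A := (jetpoly R).
Local Notation F := (jetrat R).
Local Notation toF := (@FracField.tofrac A).

(** A certificate built along the expression of [f]: a nonzero value [r] at one jet shows that [f]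
    is nonzero. *)
Definition poly_value (f : F) (r : R) : Prop :=
  exists p : A, f = toF p /\ jet_eval t p = r.

Let ev : {rmorphism A -> R} := peval idfun (jet_coord t).

Lemma poly_valueD f g r s :
  poly_value f r -> poly_value g s -> poly_value (f + g) (r + s).
Proof.
move=> [p [-> <-]] [q [-> <-]]; exists (p + q); split.
  exact/esym/(rmorphD toF).
exact: (rmorphD ev).
Qed.

Lemma poly_valueM f g r s :
  poly_value f r -> poly_value g s -> poly_value (f * g) (r * s).
Proof.
move=> [p [-> <-]] [q [-> <-]]; exists (p * q); split.
  exact/esym/(rmorphM toF).
exact: (rmorphM ev).
Qed.

Lemma poly_valueN f r : poly_value f r -> poly_value (- f) (- r).
Proof.
move=> [p [-> <-]]; exists (- p); split; first exact/esym/(rmorphN toF).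
exact: (rmorphN ev).
Qed.

Lemma poly_value_u i j : poly_value (u_ R i j) (t.2 i j).
Proof. by exists (var R (inr (i, j))); split=> //; apply: jet_eval_var. Qed.

Lemma poly_value_neq0 f r : poly_value f r -> r != 0 -> f != 0.
Proof.
move=> [p [-> <-]]; apply: contraNneq => e; apply/eqP.
have -> : p = 0 by apply/eqP; rewrite -(tofrac_eq0 p); apply/eqP.
exact: (rmorph0 ev).
Qed.
End PolynomialValue.

Section Generators.
Context (R : realType).
Local Notation A := (jetpoly R).
Local Notation F := (jetrat R).
Local Notation toF := (@FracField.tofrac A).
Local Notation D0 := (@total_derF R 0).
Local Notation D1 := (@total_derF R 1).
Local Notation U := (u_ R).
Implicit Types (f : F) (h : acsp R).

(** The jet at the origin of x + x^2/2 + y^2/2 + y^3/6. There [hess], [hess2] and the derivative of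
    [hess] along [vf2] all equal 1. *)
Definition unit_jet : jet R :=
  (0, fun i j => ((i, j) \in [:: (1, 0); (2, 0); (0, 2); (0, 3)]%N)%:R).

Local Notation u i j := (poly_value_u unit_jet i j).
Local Notation "p +v q" := (poly_valueD p q) (at level 50, left associativity).
Local Notation "p *v q" := (poly_valueM p q) (at level 40, left associativity).
Local Notation "-v p" := (poly_valueN p) (at level 35).

Lemma hess_neq0 : hess U != 0.
Proof.
rewrite /hess expr2; apply: (poly_value_neq0 (u 2 0 *v u 0 2 +v -v (u 1 1 *v u 1 1))).
by rewrite /= !mul0r mul1r subr0 oner_neq0.
Qed.

Lemma hess2_neq0 : hess2 D0 D1 U != 0.
Proof.
rewrite (hess2E (@total_derF0_u R) (@total_derF1_u R)).
apply: (poly_value_neq0 (u 1 0 *v (u 1 0 *v u 0 2 +v -v (u 0 1 *v u 1 1)) +v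
  -v (u 0 1 *v (u 1 0 *v u 1 1 +v -v (u 0 1 *v u 2 0))))).
by rewrite /= !mul0r !mul1r !subr0 oner_neq0.
Qed.

Lemma dhess_neq0 : vf D0 D1 (vf2 U) (hess U) != 0.
Proof.
rewrite (dhessE (total_derF_der R 0) (total_derF_der R 1) (@total_derF0_u R) (@total_derF1_u R)).
apply: (poly_value_neq0
  (-v u 0 1 *v (u 3 0 *v u 0 2 +v u 2 0 *v u 1 2 +v -v (u 1 1 *v u 2 1 +v u 1 1 *v u 2 1)) +v
   u 1 0 *v (u 2 1 *v u 0 2 +v u 2 0 *v u 0 3 +v -v (u 1 1 *v u 1 2 +v u 1 1 *v u 1 2)))).
by rewrite /= !mul0r !mul1r oppr0 mul0r !addr0 !add0r oppr0 addr0 oner_neq0.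
Qed.

Definition gens := tnth [tuple I0 R; I3a'' R; I3b'' R].
Definition ders := tnth [tuple nabla1'' R; nabla2'' R].

Lemma apply_derE w f : apply_der w f = vf D0 D1 w f.
Proof. reflexivity. Qed.

Lemma hess_def : I2' R = hess U.
Proof. reflexivity. Qed.

Lemma vf1_def : nabla1' R = vf1 U.
Proof. reflexivity. Qed.

Lemma vf2_def : nabla2 R = vf2 U.
Proof. reflexivity. Qed.

Lemma inv3a_def : I3a'' R = inv3a D0 D1 U.
Proof. rewrite /I3a'' apply_derE hess_def vf1_def. reflexivity. Qed.

Lemma inv3b_def : I3b'' R = inv3b D0 D1 U.
Proof. rewrite /I3b'' apply_derE hess_def vf2_def. reflexivity. Qed.

Lemma frame1_def : nabla1'' R = frame1 U.
Proof. rewrite /nabla1'' hess_def vf1_def. reflexivity. Qed.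

Lemma frame2_def : nabla2'' R = frame2 D0 D1 U.
Proof. rewrite /nabla2'' apply_derE hess_def vf2_def. reflexivity. Qed.

Lemma dersE c : ders c = frame D0 D1 U c.
Proof.
move: c; apply: I2_cases; rewrite /ders (tnth_nth (0, 0)).
  exact frame1_def.
exact frame2_def.
Qed.

Lemma gens0 i : val i = 0%N -> gens i = U 0 0.
Proof. by move=> e; rewrite /gens (tnth_nth 0) e. Qed.
Lemma gens1 i : val i = 1%N -> gens i = inv3a D0 D1 U.
Proof. move=> e; rewrite /gens (tnth_nth 0) e; exact inv3a_def. Qed.
Lemma gens2 i : val i = 2%N -> gens i = inv3b D0 D1 U.
Proof. move=> e; rewrite /gens (tnth_nth 0) e; exact inv3b_def. Qed.

Lemma gens_ind (P : F -> Prop) :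
  P (U 0%N 0%N) -> P (inv3a D0 D1 U) -> P (inv3b D0 D1 U) -> forall i, P (gens i).
Proof.
move=> P0 P1 P2 i; have : (val i < 3)%N by case: i.
case E : (val i) => [|[|[|n]]] h; last by exfalso.
- by rewrite (gens0 E).
- by rewrite (gens1 E).
- by rewrite (gens2 E).
Qed.

Lemma gens_pred (P : F -> Prop) : (forall i, P (gens i)) ->
  [/\ P (U 0%N 0%N), P (inv3a D0 D1 U) & P (inv3b D0 D1 U)].
Proof.
move=> h; split.
- by have := h (inord 0); rewrite gens0 //= inordK.
- by have := h (inord 1); rewrite gens1 //= inordK.
- by have := h (inord 2); rewrite gens2 //= inordK.
Qed.
End Generators.

Lemma add00 (V : nmodType) (x y : V) : x = 0 -> y = 0 -> x + y = 0.
Proof. by move=> -> ->; rewrite addr0. Qed.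

Lemma mulx0 (V : pzRingType) (x y : V) : y = 0 -> x * y = 0.
Proof. by move=> ->; rewrite mulr0. Qed.

Lemma fmorph_fix_div (F : fieldType) (phi : {rmorphism F -> F}) x y :
  phi x = x -> phi y = y -> phi (x / y) = x / y.
Proof. by move=> ex ey; rewrite fmorph_div ex ey. Qed.

Lemma cross_div (F : fieldType) (x y z w : F) : y != 0 -> w != 0 ->
  x * w = z * y -> x / y = z / w.
Proof. by move=> y0 w0 e; apply/eqP; rewrite eqr_div // e. Qed.

(** * The field generated by the invariants and the reduction to generation *)

Section QuotientField.
Context (A : comNzRingType) (F : fieldType) (t : {rmorphism A -> F}).

Definition quotients (f : F) : Prop := exists p q, t q != 0 /\ f = t p / t q.

Lemma image_quotients p : quotients (t p).
Proof. by exists p, 1; rewrite rmorph1 divr1 oner_neq0. Qed.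

Lemma quotients_closed : field_closed quotients.
Proof.
split=> [|f g [p [q [q0 ->]]] [p' [q' [q'0 ->]]]|f g [p [q [q0 ->]]] [p' [q' [q'0 ->]]]].
- by rewrite -(rmorph1 t); apply: image_quotients.
- by exists (p * q' - p' * q), (q * q'); rewrite quotB // rmorphM mulf_neq0.
(* Division by a zero quotient gives 0, represented by 0 / 1. *)
have [p0|p0] := eqVneq (t p') 0.
  by exists 0, 1; rewrite rmorph1 rmorph0 oner_neq0 p0 !mul0r invr0 mulr0.
by exists (p * q'), (q * p'); rewrite !rmorphM mulf_neq0 // invf_div mulf_div.
Qed.

Lemma quotients_der (d : F -> F) (d' : A -> A) f : is_der d ->
  (forall p, t (d' p) = d (t p)) -> quotients f -> quotients (d f).
Proof.
move=> dP e [p [q [q0 ->]]]; rewrite (der_div dP) // -!e.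
exists (d' p * q - p * d' q), (q * q).
by rewrite rmorphB !rmorphM mulf_neq0 // expr2.
Qed.
End QuotientField.

Section LieTresse.
Context (R : realType).
Local Notation A := (jetpoly R).
Local Notation F := (jetrat R).
Local Notation C := (@malgC {cmonom Defs.coord} R).
Local Notation toF := (@FracField.tofrac A).
Local Notation D0 := (@total_derF R 0).
Local Notation D1 := (@total_derF R 1).
Local Notation U := (u_ R).
Local Notation gens := (gens R).
Local Notation ders := (ders R).
Local Notation formal := {malg R[{cmonom ('I_3 * seq 'I_2)%type}]}.
Implicit Types (f : F) (h : acsp R) (P Q : formal).

Lemma lin_invF_const h a i j : total_derF a (lin_invF h i j) = 0.
Proof. by rewrite mxE; apply: total_derF_const. Qed.

Lemma pullbackR_ders h c f :
  pullbackR h (apply_der (ders c) f) = apply_der (ders c) (pullbackR h f).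
Proof.
rewrite dersE !apply_derE.
exact: (P_frame (total_derF_der R 0) (total_derF_der R 1)
  (@total_derF0_u R) (@total_derF1_u R) (hess_neq0 R) (dhess_neq0 R)
  (det_lin_invF h) (lin_invF_const h 0) (lin_invF_const h 1)
  (pullbackR_total_der h 0) (pullbackR_total_der h 1) (pullbackR_u h)).
Qed.

Lemma pullbackR_gens h i : pullbackR h (gens i) = gens i.
Proof.
apply: (gens_ind (P := fun f => pullbackR h f = f)).
- exact: pullbackR_u.
- exact: (P_inv3a (total_derF_der R 0) (total_derF_der R 1)
  (@total_derF0_u R) (@total_derF1_u R) (hess_neq0 R)
  (det_lin_invF h) (lin_invF_const h 0) (lin_invF_const h 1)
  (pullbackR_total_der h 0) (pullbackR_total_der h 1) (pullbackR_u h)).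
- exact: (P_inv3b (total_derF_der R 0) (total_derF_der R 1)
  (@total_derF0_u R) (@total_derF1_u R) (hess_neq0 R)
  (det_lin_invF h) (lin_invF_const h 0) (lin_invF_const h 1)
  (pullbackR_total_der h 0) (pullbackR_total_der h 1) (pullbackR_u h)).
Qed.

Definition symbol_value (s : 'I_3 * seq 'I_2) : F := iter_der ders s.2 (gens s.1).

Definition realizeR : {rmorphism formal -> F} := peval (constF R) symbol_value.

Lemma realizeRC c : realizeR c%:MP = constF R c.
Proof. exact: (pevalC (constF R) symbol_value). Qed.

Lemma realizeRX s : realizeR << ucm s >> = symbol_value s.
Proof. exact: (pevalX (constF R) symbol_value). Qed.

Lemma pullbackR_symbol h s : pullbackR h (symbol_value s) = symbol_value s.
Proof.
case: s => i; elim=> [|j J IHJ]; first exact: pullbackR_gens.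
by apply: etrans (pullbackR_ders _ _ _) _; congr apply_der.
Qed.

Lemma pullbackR_realize h P : pullbackR h (realizeR P) = realizeR P.
Proof.
apply: etrans (peval_comp (c := constF R) (phi := pullbackR h) (c' := constF R) _ _ _) _.
  exact: pullbackR_const.
apply: peval_ext => s; exact: pullbackR_symbol.
Qed.

Lemma ders_der j : is_der (apply_der (ders j)).
Proof. exact: (vf_der (total_derF_der R 0) (total_derF_der R 1)). Qed.

(** Makes the kernel of [realizeR] a differential ideal and [generated] stable under the invariant
    derivations. *)
Lemma realize_formal_der j P :
  realizeR (formal_der j P) = apply_der (ders j) (realizeR P).
Proof.
have dP := ders_der j.
apply: (malg_der_ext (phi := realizeR) (d := fun P => realizeR (formal_der j P))
  (d' := fun P => apply_der (ders j) (realizeR P))).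
- move=> c; apply: etrans (congr1 _ (poly_derC _ c)) _.
  apply: etrans (rmorph0 realizeR) _; rewrite realizeRC apply_derE /vf !total_derF_const.
  by rewrite !mulr0 addr0.
- move=> s; apply: etrans (congr1 _ (poly_derX _ s)) _.
  apply: etrans (realizeRX _) _.
  exact: (congr1 (apply_der (ders j)) (esym (realizeRX s))).
- move=> p q; apply: etrans (congr1 _ (poly_derD _ p q)) _; exact: (rmorphD realizeR).
- by move=> p q; rewrite (rmorphD realizeR) (derD dP).
- move=> p q; apply: etrans (congr1 _ (poly_derM _ p q)) _.
  rewrite (rmorphD realizeR); congr (_ + _); exact: (rmorphM realizeR).
- by move=> p q; rewrite (rmorphM realizeR) (derM dP).
Qed.

(** Convertible to [rational_expr], but phrased with a bundled morphism, to which the facts on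
    quotients apply. *)
Definition generated : F -> Prop := quotients realizeR.


Lemma generated_closed : field_closed generated.
Proof. exact: quotients_closed. Qed.

Lemma generated_realize P : generated (realizeR P).
Proof. exact: image_quotients. Qed.

Lemma generated_gens i : generated (gens i).
Proof. by rewrite -[gens i](realizeRX (i, [::])); apply: generated_realize. Qed.

Lemma generated_const c : generated (constF R c).
Proof. by rewrite -realizeRC; apply: generated_realize. Qed.

Lemma generated_ders j f : generated f -> generated (apply_der (ders j) f).
Proof. exact: (quotients_der (ders_der j) (realize_formal_der j)). Qed.

(** The fractions regular at the jet and at its image may differ. The second one, pulled back,
    equals the first; cross-multiplied, this is a polynomial identity that can be evaluated at the
    jet. *)
Lemma pullbackR_fixed_invariant f : (forall h, pullbackR h f = f) -> diff_invariant f.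
Proof.
move=> fix_f h t v w [p [q [qt ef ->]]] [p' [q' [qt' ef' ->]]].
have q0 : q != 0 by apply: contraNneq qt => ->; apply/eqP; apply: (rmorph0 (peval idfun (jet_coord t))).
have q'0 : q' != 0 by apply: contraNneq qt' => ->; apply/eqP; apply: (rmorph0 (peval idfun (jet_coord (prolong h t)))).
have := fix_f h; rewrite {1}ef' ef.
move=> e; have := etrans (esym (frac_mapE (@pullback_inj R h) p' q'0)) e.
move/(frac_eq _ _ (phi_neq0 (@pullback_inj R h) q'0) q0).
pose ev : {rmorphism A -> R} := peval idfun (jet_coord t).
move=> e1; pose a := pullback h p'; pose b := pullback h q'.
have e2 : ev a * ev q = ev p * ev b.
  exact: etrans (esym (rmorphM ev a q)) (etrans (congr1 ev e1) (rmorphM ev p b)).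
have ea : ev a = jet_eval (prolong h t) p' := jet_eval_pullback h t p'.
have eb : ev b = jet_eval (prolong h t) q' := jet_eval_pullback h t q'.
refine (cross_div qt' qt _).
refine (etrans (congr1 (fun z => z * jet_eval t q) (esym ea)) _).
refine (etrans e2 _).
exact (congr1 (fun z => jet_eval t p * z) eb).
Qed.

Lemma generated_invariant f : generated f -> diff_invariant f.
Proof.
move=> [P [Q [Q0 ->]]]; apply: pullbackR_fixed_invariant => h.
exact: (fmorph_fix_div (pullbackR_realize h P) (pullbackR_realize h Q)).
Qed.

(** All relations are taken as syzygies: they form the kernel of [realizeR], already a differential
    ideal and hence the one it generates. *)
Lemma lie_tresse_of_generation :
  (forall f, diff_invariant f -> generated f) ->
  lie_tresse gens ders (@diff_invariant R) (fun P => realize gens ders P = 0).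
Proof.
move=> gen; split.
- by move=> i; apply: generated_invariant; apply: generated_gens.
- by move=> j h f; rewrite !pullbackFE; apply: pullbackR_ders.
- by move=> f; split; [apply: gen|apply: generated_invariant].
move=> P; split=> [P0 K _ _ _ _|]; first by apply.
move=> H; apply: (H (fun P => realizeR P = 0)) => [|X Y X0 Y0|X Y Y0|j X X0|X X0].
- exact: (rmorph0 realizeR).
- exact: etrans (rmorphD realizeR X Y) (add00 X0 Y0).
- exact: etrans (rmorphM realizeR X Y) (mulx0 _ Y0).
- apply: etrans (realize_formal_der j X) _.
  by apply: etrans (congr1 _ X0) _; apply: (der0 (ders_der j)).
- exact X0.
Qed.
End LieTresse.

(** For such a shift the diagonal dominates the off-diagonal entries. *)
Lemma det_add_scalar_gt0 (R : realFieldType) (G : 'M[R]_2) (s : R) :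
  `|G 0 0| + `|G 0 1| + `|G 1 0| + `|G 1 1| + 1 <= s -> 0 < \det (G + s%:M).
Proof.
move=> hs; have le_n (a : R) : - `|a| <= a.
  by have := ler_norm (- a); rewrite normrN lerNl.
have n00 := normr_ge0 (G 0 0); have n01 := normr_ge0 (G 0 1).
have n10 := normr_ge0 (G 1 0); have n11 := normr_ge0 (G 1 1).
have h00 : `|G 0 1| + 1 <= G 0 0 + s by have := le_n (G 0 0); lra.
have h11 : `|G 1 0| + 1 <= G 1 1 + s by have := le_n (G 1 1); lra.
rewrite det_mx2 !mxE /= !mulr1n !mulr0n !addr0.
have h : (`|G 0 1| + 1) * (`|G 1 0| + 1) <= (G 0 0 + s) * (G 1 1 + s).
  by apply: ler_pM => //; rewrite addr_ge0.
have k : G 0 1 * G 1 0 <= `|G 0 1| * `|G 1 0| by rewrite -normrM ler_norm.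
lra.
Qed.

(** * Invariance as a polynomial identity *)

Section JetPoint.
Context (R : comNzRingType).

Definition jet_point (S : comNzRingType) (x : 'I_2 -> S) (U : nat -> nat -> S)
    (c : Defs.coord) : S :=
  match c with inl a => x a | inr (i, j) => U i j end.

Lemma jet_point_ext (S : comNzRingType) (x y : 'I_2 -> S) (U W : nat -> nat -> S) :
  x =1 y -> U =2 W -> jet_point x U =1 jet_point y W.
Proof. by move=> ex eU [a|[i j]] /=. Qed.

Context (p q : {malg R[{cmonom Defs.coord}]}).

(* Vanishes, as a function of the jet [(x, U)], of the new base point [x'] and of
   the matrix [G], iff [p / q] is constant along the action, [G] being the inverse
   of the linear part. *)
Definition cross (S : comNzRingType) (c : {rmorphism R -> S}) x U x' G : S :=
  peval c (jet_point x' (twist G U)) p * peval c (jet_point x U) q -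
  peval c (jet_point x U) p * peval c (jet_point x' (twist G U)) q.

(** Nonzero where the fraction p / q can be evaluated both at the jet and at its image. *)
Definition denoms (S : comNzRingType) (c : {rmorphism R -> S}) x U x' G : S :=
  peval c (jet_point x U) q * peval c (jet_point x' (twist G U)) q.

Section Natural.
Context (S T : comNzRingType) (c : {rmorphism R -> S}) (phi : {rmorphism S -> T}).
Context (c' : {rmorphism R -> T}) (phic : forall a, phi (c a) = c' a).
Context (x : 'I_2 -> S) (U : nat -> nat -> S) (x' : 'I_2 -> S) (G : 'M[S]_2).
Context (y : 'I_2 -> T) (W : nat -> nat -> T) (y' : 'I_2 -> T) (H : 'M[T]_2).
Hypotheses (xy : forall a, phi (x a) = y a) (UW : forall i j, phi (U i j) = W i j).
Hypotheses (xy' : forall a, phi (x' a) = y' a) (GH : forall a b, phi (G a b) = H a b).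

Lemma peval_jet_natural r :
  phi (peval c (jet_point x U) r) = peval c' (jet_point y W) r.
Proof.
rewrite (peval_comp (jet_point x U) r phic); apply: peval_ext => -[a|[i j]] /=.
  exact: xy.
exact: UW.
Qed.

Lemma peval_twist_natural r :
  phi (peval c (jet_point x' (twist G U)) r) = peval c' (jet_point y' (twist H W)) r.
Proof.
rewrite (peval_comp _ r phic); apply: peval_ext => -[a|[i j]] /=; first exact: xy'.
rewrite twist_map (_ : map_mx phi G = H); last by apply/matrixP => a b; rewrite mxE.
exact: twist_ext.
Qed.

Lemma cross_natural : phi (cross c x U x' G) = cross c' y W y' H.
Proof.
rewrite /cross rmorphB !rmorphM.
by rewrite !peval_jet_natural !peval_twist_natural.
Qed.

Lemma denoms_natural : phi (denoms c x U x' G) = denoms c' y W y' H.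
Proof.
by rewrite /denoms rmorphM peval_jet_natural peval_twist_natural.
Qed.
End Natural.
End JetPoint.

Section UniversalIdentity.
Context (R : realType) (p q : jetpoly R).
Hypothesis q0 : q != 0.
Local Notation C := (@malgC {cmonom Defs.coord} R).

Hypothesis inv_pos : forall (x : 'I_2 -> R) U x' G, 0 < \det G ->
  denoms q idfun x U x' G != 0 -> cross p q idfun x U x' G = 0.

(* The constraint [0 < \det G] is removed by shifting [G] along the scalars: a
   polynomial in the shift vanishing at all large values is zero. *)
Lemma cross_denoms_eq0 (x : 'I_2 -> R) U x' G :
  cross p q idfun x U x' G * denoms q idfun x U x' G = 0.
Proof.
pose B : R := `|G 0 0| + `|G 0 1| + `|G 1 0| + `|G 1 1| + 1.
pose ev (s : R) : {rmorphism {poly R} -> R} := horner_eval s.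
pose Gp : 'M[{poly R}]_2 := map_mx polyC (G + B%:M) + ('X)%:M.
pose xp a := (x a)%:P; pose Up i j := (U i j)%:P; pose xp' a := (x' a)%:P.
pose T := cross p q (@polyC R) xp Up xp' Gp * denoms q (@polyC R) xp Up xp' Gp.
have evT s : ev s T = cross p q idfun x U x' (G + (B + s)%:M) *
    denoms q idfun x U x' (G + (B + s)%:M).
  have evC a : ev s (polyC a) = [the {rmorphism R -> R} of idfun] a by rewrite /ev /= /horner_eval hornerC.
  have evG a b : ev s (Gp a b) = (G + (B + s)%:M) a b.
    rewrite !mxE rmorphD evC rmorphMn /= /horner_eval hornerX.
    by case: (a == b); rewrite ?mulr1n ?mulr0n ?addr0 ?addrA.
  rewrite rmorphM; congr (_ * _).
    by apply: (cross_natural p q evC) => // *; rewrite ?evC ?evG.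
  by apply: (denoms_natural q evC) => // *; rewrite ?evC ?evG.
have T0 : T = 0.
  apply/eqP; apply: contraT => nT.
  have [|n] := exists_nonroot _ nT; first by move=> n; rewrite pnatr_eq0.
  rewrite -[T.[_]]/(ev n%:R T) evT.
  have pos : 0 < \det (G + (B + n%:R)%:M).
    by apply: det_add_scalar_gt0; rewrite lerDl ler0n.
  have [->|nd] := eqVneq (denoms q idfun x U x' (G + (B + n%:R)%:M)) 0.
    by rewrite mulr0 eqxx.
  by rewrite (inv_pos pos nd) mul0r eqxx.
(* At s = - B the total shift B + s is 0, which recovers [G] itself. *)
by have := evT (- B); rewrite T0 rmorph0 subrr raddf0 addr0 => <-.
Qed.

(** Independent variables for the jet, then for the entries of G, then for the new base point. Every
    choice of these data in an algebra is a specialization, which is what [universal] records. *)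
Definition ext_coord : countType := (Defs.coord + ('I_2 * 'I_2 + 'I_2))%type.
Local Notation E := {malg R[{cmonom ext_coord}]}.
Local Notation CE := (@malgC {cmonom ext_coord} R).
Let V (s : ext_coord) : E := << ucm s >>.
Let ex (a : 'I_2) := V (inl (inl a)).
Let eU i j := V (inl (inr (i, j))).
Let ex' (a : 'I_2) := V (inr (inr a)).
Let eG : 'M[E]_2 := \matrix_(a, b) V (inr (inl (a, b))).

Let target (S : comNzRingType) (x : 'I_2 -> S) (U : nat -> nat -> S) (x' : 'I_2 -> S)
    (G : 'M[S]_2) (s : ext_coord) : S :=
  match s with
  | inl c => jet_point x U c
  | inr (inl (a, b)) => G a b
  | inr (inr a) => x' a
  end.

Let spec (S : comNzRingType) (c : {rmorphism R -> S}) x U x' G : {rmorphism E -> S} :=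
  peval c (target x U x' G).

Let universal (S : comNzRingType) (c : {rmorphism R -> S}) x U x' G :
  spec c x U x' G (cross p q CE ex eU ex' eG) = cross p q c x U x' G /\
  spec c x U x' G (denoms q CE ex eU ex' eG) = denoms q c x U x' G.
Proof.
have phiC a : spec c x U x' G (CE a) = c a := pevalC c (target x U x' G) a.
have phix a : spec c x U x' G (ex a) = x a := pevalX c (target x U x' G) (inl (inl a)).
have phiU i j : spec c x U x' G (eU i j) = U i j :=
  pevalX c (target x U x' G) (inl (inr (i, j))).
have phix' a : spec c x U x' G (ex' a) = x' a :=
  pevalX c (target x U x' G) (inr (inr a)).
have phiG a b : spec c x U x' G (eG a b) = G a b.
  rewrite mxE; exact: (pevalX c (target x U x' G) (inr (inl (a, b)))).
split.
  exact: (cross_natural p q phiC phix phiU phix' phiG).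
exact: (denoms_natural q phiC phix phiU phix' phiG).
Qed.

(** At the identity transformation, x' = x and G = 1, it specializes to q * q. *)
Let denoms_neq0 : denoms q CE ex eU ex' eG != 0.
Proof.
apply/eqP => e0.
pose vx a := var R (inl a).
have [_ e] := universal C vx (@var_u R) vx 1%:M.
have idE r : peval C (@var R) r = r.
  exact/esym/(peval_unique (c := C) (phi := idfun)).
have eq1 : peval C (jet_point vx (@var_u R)) q = q.
  by apply: etrans (idE q); apply: peval_ext => -[a|[i j]].
have eq2 : peval C (jet_point vx (twist 1%:M (@var_u R))) q = q.
  apply: etrans eq1; apply: peval_ext => -[a|[i j]] //=; exact: twist1.
have e2 : denoms q C vx (@var_u R) vx 1%:M = 0.
  by apply: etrans (esym e) _; apply: etrans (congr1 _ e0) (rmorph0 _).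
have : q * q = 0 := etrans (esym (congr2 *%R eq1 eq2)) e2.
by apply/eqP; rewrite mulf_neq0.
Qed.

(** The product of the universal [cross] and [denoms] vanishes at all real points, hence is the zero
    polynomial. In a domain the nonzero factor [denoms] cancels, and the result specializes to any
    algebra. *)
Lemma cross_eq0 (S : comNzRingType) (c : {rmorphism R -> S}) x U x' G :
  cross p q c x U x' G = 0.
Proof.
suff e : cross p q CE ex eU ex' eG = 0.
  have [<- _] := universal c x U x' G.
  exact: etrans (congr1 _ e) (rmorph0 _).
have e : cross p q CE ex eU ex' eG * denoms q CE ex eU ex' eG = 0.
  apply/eqP; apply: contraT => /exists_nonzero_value[|v].
    by move=> n; rewrite pnatr_eq0.
  pose val s : R := (v s)%:R.
  pose x1 a := val (inl (inl a)); pose U1 i j := val (inl (inr (i, j))).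
  pose x1' a := val (inr (inr a)); pose G1 := \matrix_(a, b) val (inr (inl (a, b))).
  have [e1 e2] := universal idfun x1 U1 x1' G1.
  have ev : peval idfun (fun i => (v i)%:R) =1 spec idfun x1 U1 x1' G1.
    by apply: peval_ext => -[[a|[i j]]|[[a b]|a]] //=; rewrite mxE.
  case/negP; apply/eqP; apply: etrans (ev _) _.
  apply: etrans (rmorphM _ _ _) _; apply: etrans (congr2 *%R e1 e2) _.
  exact: cross_denoms_eq0.
apply/eqP; move/eqP: e; rewrite mulf_eq0 => /orP[//|].
by rewrite (negbTE denoms_neq0).
Qed.
End UniversalIdentity.

(** * Matrices of positive determinant as group elements *)

Section OrbitIdentity.
Context (R : realType).
Implicit Types (G : 'M[R]_2).

Lemma omega_mul (M : 'M[R]_2) v w : omega (M *m v) (M *m w) = \det M * omega v w.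
Proof. rewrite /omega !mxE !sum_I2 det_mx2; ring. Qed.

(** In dimension two a matrix of determinant 1 is symplectic: G^-1 becomes so after scaling by r =
    sqrt (det G), and the dilation 1 / r compensates. *)
Lemma acsp_of_matrix G (b : 'cV[R]_2) : 0 < \det G ->
  exists h : acsp R, lin h = invmx G /\ translation h = b.
Proof.
move=> detG; pose r := Num.sqrt (\det G).
have r0 : 0 < r by rewrite sqrtr_gt0.
have Gu : G \in unitmx by rewrite unitmxE unitfE gt_eqF.
have sp v w : omega ((r *: invmx G) *m v) ((r *: invmx G) *m w) = omega v w.
  rewrite omega_mul detZ det_inv sqr_sqrtr ?ltW // mulfV ?mul1r // gt_eqF //.
have rV : 0 < r^-1 by rewrite invr_gt0.
exists (Acsp b sp rV); split=> //.
by rewrite /lin /= scalerA mulVf ?scale1r // gt_eqF.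
Qed.

Lemma cross_eq0_of_invariant (p q : jetpoly R) : q != 0 ->
    diff_invariant (FracField.tofrac p / FracField.tofrac q) ->
  forall (x : 'I_2 -> R) U x' G, 0 < \det G ->
    denoms q idfun x U x' G != 0 -> cross p q idfun x U x' G = 0.
Proof.
move=> q0 inv x U x' G detG.
pose t : jet R := (\col_a x a, U).
(* The translation is chosen to carry the base point x to x'. *)
have [h [linh trh]] := acsp_of_matrix (\col_a x' a - invmx G *m t.1) detG.
have et : jet_coord t =1 jet_point x U by move=> [a|[i j]] //=; rewrite mxE.
have eh : jet_coord (prolong h t) =1 jet_point x' (twist G U).
  move=> [a|[i j]]; last by rewrite /jet_coord prolong_u /lin_inv linh invmxK.
  by rewrite /= /act linh trh addrC subrK mxE.
rewrite /denoms /cross -!(peval_ext idfun et) -!(peval_ext idfun eh).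
rewrite mulf_eq0 negb_or => /andP[qt qht].
have ht r : has_value (FracField.tofrac p / FracField.tofrac q) r
    (jet_eval r p / jet_eval r q) \/ jet_eval r q = 0.
  by have [->|r0] := eqVneq (jet_eval r q) 0; [right|left; exists p, q].
case: (ht t) => [vt|e]; last by rewrite -[peval _ _ q]/(jet_eval t q) e eqxx in qt.
case: (ht (prolong h t)) => [vht|e]; last first.
  by rewrite -[peval _ _ q]/(jet_eval (prolong h t) q) e eqxx in qht.
have /eqP := inv h t _ _ vt vht; rewrite eqr_div // => /eqP e.
by apply/eqP; rewrite subr_eq0; apply/eqP; exact: e.
Qed.

End OrbitIdentity.

(** * Specialization to a constant multiple of the frame *)

Lemma map_mx_entry (S T : Type) (phi : S -> T) (m n : nat) (N : 'M[S]_(m, n)) a b :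
  map_mx phi N a b = phi (N a b).
Proof. exact: mxE. Qed.

(* A translate of the frame avoids the poles of a given fraction: the denominator,
   as a polynomial in the translation, is nonzero since it is so at [M^-1]. *)
Lemma exists_nonzero_translate (R : comNzRingType) (F : fieldType)
    (c : {rmorphism R -> F}) (q : {malg R[{cmonom Defs.coord}]})
    (x : 'I_2 -> F) (U : nat -> nat -> F) (M : 'M[F]_2) :
    (forall n, n.+1%:R != 0 :> F) -> M \in unitmx ->
    peval c (jet_point x U) q != 0 ->
  exists (y : 'I_2 -> nat) (H : 'M[nat]_2),
    peval c (jet_point (fun a => (y a)%:R) (twist (M *m map_mx (fun n => n%:R) H) U)) q != 0.
Proof.
move=> char0 Mu q0.
pose I : countType := ('I_2 * 'I_2 + 'I_2)%type.
pose E := {malg F[{cmonom I}]}.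
pose CE : {rmorphism F -> E} := @malgC {cmonom I} F.
pose cE : {rmorphism R -> E} := CE \o c.
pose V (s : I) : E := << ucm s >>.
pose VG : 'M[E]_2 := \matrix_(a, b) V (inl (a, b)).
pose UE i j := CE (U i j).
pose Q : E := peval cE (jet_point (fun a => V (inr a)) (twist (map_mx CE M *m VG) UE)) q.
have spec (v : I -> F) : peval idfun v Q = peval c (jet_point (fun a => v (inr a))
    (twist (M *m \matrix_(a, b) v (inl (a, b))) U)) q.
  pose phi : {rmorphism E -> F} := peval idfun v.
  have phiC a : phi (CE a) = a := pevalC idfun v a.
  have phiV s : phi (V s) = v s := pevalX idfun v s.
  have phic a : phi (cE a) = c a := phiC (c a).
  have phiVG : map_mx phi VG = \matrix_(a, b) v (inl (a, b)).
    by apply/matrixP => a b; rewrite mxE [VG a b]mxE phiV mxE.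
  have phiM : map_mx phi (map_mx CE M) = M.
    by apply/matrixP => a b; rewrite mxE [map_mx CE M a b]mxE phiC.
  have phiMVG : map_mx phi (map_mx CE M *m VG) = M *m \matrix_(a, b) v (inl (a, b)).
    exact: etrans (map_mxM phi _ _) (congr2 mulmx phiM phiVG).
  apply: (peval_twist_natural phic (W := U)) => [i j|a|a b].
  - exact: phiC.
  - exact: phiV.
  - apply: etrans (esym (map_mx_entry phi _ a b)) _.
    exact: (congr1 (fun X : 'M_2 => X a b) phiMVG).
have Q0 : Q != 0.
  apply/eqP => e.
  pose v (s : I) := match s with inl (a, b) => invmx M a b | inr a => x a end.
  have := spec v; rewrite e => ev.
  case/eqP: q0; apply: etrans (etrans (esym ev) (rmorph0 _)).
  apply: peval_ext; apply: jet_point_ext => // i j.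
  have -> : \matrix_(a, b) v (inl (a, b)) = invmx M.
    by apply/matrixP => a b; rewrite mxE.
  by rewrite mulmxV // twist1.
have [v hv] := exists_nonzero_value char0 Q0.
exists (fun a => v (inr a)), (\matrix_(a, b) v (inl (a, b))).
apply: contraNneq hv => e; apply/eqP; apply: etrans (spec _) _; apply: etrans e.
apply: peval_ext; apply: jet_point_ext => // i j.
by congr (twist (M *m _) U i j); apply/matrixP => a b; rewrite !mxE.
Qed.

Lemma peval_closed (I : choiceType) (R : comNzRingType) (F : fieldType)
    (c : {rmorphism R -> F}) (v : I -> F) (K : F -> Prop) :
    field_closed K -> (forall a, K (c a)) -> (forall i, K (v i)) ->
  forall p, K (peval c v p).
Proof.
move=> KP Kc Kv; elim/malg_ring_ind => [a|i|p q Kp Kq|p q Kp Kq].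
- by rewrite pevalC.
- by rewrite pevalX.
- by rewrite rmorphD; apply: fcD.
- by rewrite rmorphM; apply: fcM.
Qed.

Section Generation.
Context (R : realType).
Local Notation A := (jetpoly R).
Local Notation F := (jetrat R).
Local Notation toF := (@FracField.tofrac A).
Local Notation D0 := (@total_derF R 0).
Local Notation D1 := (@total_derF R 1).
Local Notation U := (u_ R).
Local Notation M := (frame_mx D0 D1 U).

Lemma natF_neq0 n : n.+1%:R != 0 :> F.
Proof. by rewrite -(rmorph_nat (constF R)) fmorph_eq0 pnatr_eq0. Qed.

Lemma frame_mx_generated i j : generated (twist M U i j).
Proof.
have [K0 K1 K2] := gens_pred (@generated_gens R).
apply: (twist_generated (total_derF_der R 0) (total_derF_der R 1) (@total_derF0_u R)
  (@total_derF1_u R) (hess_neq0 R) (dhess_neq0 R) (hess2_neq0 R) (natF_neq0 1)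
  (generated_closed R) K0 K1 K2).
by move=> c f Kf; rewrite -dersE -apply_derE; apply: generated_ders.
Qed.

Lemma frame_mx_unit : M \in unitmx.
Proof.
rewrite unitmxE unitfE.
exact: (det_frame_mx (@total_derF0_u R) (@total_derF1_u R) (hess_neq0 R)
  (dhess_neq0 R) (hess2_neq0 R)).
Qed.

Lemma tofrac_peval p :
  toF p = peval (constF R) (jet_point (fun a => toF (var R (inl a))) U) p.
Proof.
apply: (peval_unique (phi := toF)) => [a|[a|[i j]]] //.
Qed.

Lemma invariant_generated (f : F) : diff_invariant f -> generated f.
Proof.
have q0 := denom_ratioP (repr f); rewrite (fracE f).
move: \n_(repr f) \d_(repr f) q0 => p q q0 inv.
pose x (a : 'I_2) : F := toF (var R (inl a)).
have toq0 : peval (constF R) (jet_point x U) q != 0.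
  by rewrite -tofrac_peval tofrac_eq0.
have [y [H]] := exists_nonzero_translate natF_neq0 frame_mx_unit toq0.
set y' := (fun a => (y a)%:R : F); set H' := map_mx _ H => q'0.
(* The frame is a matrix of rational functions, not of constants; the formal identity still applies
   to it, and equates p / q with its value at the twisted jet. *)
have e := cross_eq0 q0 (cross_eq0_of_invariant q0 inv) (constF R) x U y' (M *m H').
have K := generated_closed R.
have Kr r : generated (peval (constF R) (jet_point y' (twist (M *m H') U)) r).
  apply: (peval_closed K); first exact: generated_const.
  move=> [a|[i j]] /=; first exact: (fc_nat K).
  (* The coordinates of the twisted jet are combinations of the frame components with natural
     coefficients. *)
  rewrite -twistM; apply: (fc_twist K) => [a b|k l]; last exact: frame_mx_generated.
  by rewrite mxE; apply: (fc_nat K).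
suff -> : toF p / toF q = peval (constF R) (jet_point y' (twist (M *m H') U)) p /
   peval (constF R) (jet_point y' (twist (M *m H') U)) q by apply: (fc_div K).
apply: etrans (congr2 (fun a b => a / b) (tofrac_peval p) (tofrac_peval q)) _.
exact: (cross_div toq0 q'0 (esym (subr0_eq e))).
Qed.
End Generation.

Theorem mainTheorem13 (R : realType) :
  exists Rl : {malg R[{cmonom ('I_3 * seq 'I_2)%type}]} -> Prop,
    lie_tresse
      (tnth [tuple I0 R; I3a'' R; I3b'' R])
      (tnth [tuple nabla1'' R; nabla2'' R])
      (@diff_invariant R) Rl.
Proof.
exists (fun P => realize (gens R) (ders R) P = 0).
exact: (lie_tresse_of_generation (@invariant_generated R)).
Qed.
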